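(* Let $k\geq 3$ and let $H$ be a covering $k$-hypergraph. Then $H$ admits an Euler tour if and only if $H$ has at least two edges.
   Context: A hypergraph $H=(V,E)$ consists of a finite non-empty vertex set $V$ and a finite multiset $E$ of subsets of $V$, called edges (repeated edges are allowed; distinct members of the multiset are regarded as distinct edges). $H$ is $k$-uniform if every edge has exactly $k$ elements. A walk in $H$ is a sequence $v_0e_1v_1e_2\dots e_mv_m$ with $v_i\in V$, $e_i\in E$, $v_{i-1},v_i\in e_i$ and $v_{i-1}\neq v_i$ for all $i$; it is a trail if $e_1,\dots,e_m$ are pairwise distinct (as members of the multiset), and closed if $v_0=v_m$ and $m\geq 2$. An Euler tour of $H$ is a closed trail that traverses every edge of $H$ exactly once. For $k\geq 3$, a covering $k$-hypergraph is a $k$-uniform hypergraph with at least one edge in which every $(k-1)$-subset of $V$ is contained in at least one edge. *)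

(* Defs.v *)
From mathcomp Require Import all_boot.

Set Implicit Arguments.
Unset Strict Implicit.
Unset Printing Implicit Defensive.

(* The multiset of edges is a family of subsets of [vertex] indexed by the      *)
(* finite type [edge]: the elements of [edge] are the members of the multiset,  *)
(* and distinct ones may have the same underlying set [vset e].                 *)
Record hypergraph := Hypergraph {
  vertex : finType;
  edge : finType;
  vset : edge -> {set vertex};
  vertex_nonempty : 0 < #|vertex|
}.

Definition uniform (k : nat) (H : hypergraph) : Prop :=
  forall e : edge H, #|vset e| = k.

(* The sequence v_0 e_1 v_1 ... e_m v_m is represented by its first vertex v_0  *)
(* and the list s = [:: (e_1, v_1); ...; (e_m, v_m)].                           *)
Fixpoint walk (H : hypergraph) (v : vertex H) (s : seq (edge H * vertex H)) :
    bool :=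
  if s is (e, w) :: s' then
    [&& v \in vset e, w \in vset e, v != w & walk w s']
  else true.

Definition walk_edges (H : hypergraph) (s : seq (edge H * vertex H)) :
  seq (edge H) := unzip1 s.

Definition walk_end (H : hypergraph) (v : vertex H)
  (s : seq (edge H * vertex H)) : vertex H := last v (unzip2 s).

Definition trail (H : hypergraph) (v : vertex H)
  (s : seq (edge H * vertex H)) : Prop := walk v s /\ uniq (walk_edges s).

Definition closed_walk (H : hypergraph) (v : vertex H)
  (s : seq (edge H * vertex H)) : Prop := v = walk_end v s /\ 2 <= size s.

Definition Euler_tour (H : hypergraph) (v : vertex H)
  (s : seq (edge H * vertex H)) : Prop :=
  [/\ trail v s, closed_walk v s &
      forall e : edge H, count_mem e (walk_edges s) = 1].

Definition has_Euler_tour (H : hypergraph) : Prop :=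
  exists (v : vertex H) (s : seq (edge H * vertex H)), Euler_tour v s.

Definition covering_hypergraph (k : nat) (H : hypergraph) : Prop :=
  [/\ uniform k H, 1 <= #|edge H| &
      forall S : {set vertex H}, #|S| = k - 1 ->
        exists e : edge H, S \subset vset e].

(* Main.v *)
Require Import Defs.
From mathcomp Require Import all_boot zify.

Set Implicit Arguments.
Unset Strict Implicit.
Unset Printing Implicit Defensive.

(* For k >= 4 take a longest closed trail T and an edge e outside it. Among the *)
(* pairs of an outside and an inside edge some pair meets in k - 2 vertices, as *)
(* otherwise a third edge meeting both would give a better pair. Local          *)
(* rerouting (inserting e at a vertex of T, exchanging it with an edge of T, or *)
(* reversing the part of T between two passages through a vertex) then extends  *)
(* T.                                                                           *)
(*                                                                              *)
(* For k = 3 choosing a spare vertex in every triple turns the hypergraph into  *)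
(* a multigraph. Moving one choice flips two degree parities, and chains of     *)
(* such moves flip the parities at any prescribed pair of vertices, so some     *)
(* choice makes all degrees even. Take a closed trail T and an even choice on   *)
(* the remaining edges R with T as long as possible. Then R spans no trail      *)
(* meeting T, and no vertex pair whose parities R can flip is joined by a       *)
(* rerouting of T. This forces each vertex of T to be covered by R together     *)
(* with all or with none of the vertices off T; every distribution of these two *)
(* kinds is contradictory.                                                      *)

(** * Trails as lists of darts *)

(** A closed trail has length at least two, so one direction is immediate. The other rests on the
    rigidity of a maximal closed trail [T]: no rerouting may absorb further edges.

    For [k >= 4], [close_pair] and [longest_free_pair] give an edge [e] off [T] and an edge [f] of
    [T] that share [k - 2] vertices, with the entry and exit vertices of [f] outside [e]. Covering
    suitable [(k - 1)]-sets yields two more edges of [T] incident to the same end [u] of [f]. Two of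
    these three passages have the same direction at [u], and reversing the part of [T] between them
    absorbs [e] ([longest_covers]).

    By [noflip], if the edges of [T] can be rearranged into a trail from [q] to [p], then [R] cannot
    flip the parities of [p] and [q]. Call a touched vertex near an untouched one if an edge of [R]
    contains both. Near pairs can be flipped, other such pairs cannot. A touched vertex is near all
    untouched vertices or none ([near_all_or_none]); exactly one is near ([some_near],
    [near_unique]) and some are not ([some_far]). The edge of [T] on the near vertex and a far one
    gives [maximal_contradiction]. *)

Section Trails.
Variable H : hypergraph.
Local Notation V := (vertex H).
Local Notation E := (edge H).

(* A dart [(u, e, v)] is an edge with its entry and exit vertices. *)
Definition dart := (V * E * V)%type.

Definition dart_edges (T : seq dart) : seq E := [seq d.1.2 | d <- T].

Fixpoint dart_walk (x : V) (T : seq dart) (y : V) : bool :=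
  if T is (u, e, v) :: T' then
    [&& x == u, u \in vset e, v \in vset e, u != v & dart_walk v T' y]
  else x == y.

Definition closed_trail (T : seq dart) : bool :=
  [exists x, dart_walk x T x] && uniq (dart_edges T).

Definition joins (x : V) (es : seq E) (y : V) : Prop :=
  exists2 T, dart_walk x T y & dart_edges T = es.

Lemma dart_walk_cat x T1 T2 y :
  reflect (exists2 z, dart_walk x T1 z & dart_walk z T2 y)
          (dart_walk x (T1 ++ T2) y).
Proof.
elim: T1 x => [|[[u e] v] T1 IH] x /=.
  apply: (iffP idP) => [h|[z /eqP-> //]]; by exists x.
apply: (iffP and5P) => [[h1 h2 h3 h4 /IH[z h5 h6]]|[z /and5P[h1 h2 h3 h4 h5] h6]].
  by exists z => //; apply/and5P.
by split=> //; apply/IH; exists z.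
Qed.

Lemma joins0 x : joins x [::] x.
Proof. by exists [::] => /=. Qed.

Lemma joins_cons x e y es z : x \in vset e -> y \in vset e -> x != y ->
  joins y es z -> joins x (e :: es) z.
Proof.
move=> xe ye xy [T wT eT]; exists ((x, e, y) :: T); last by rewrite /= eT.
by rewrite /= eqxx xe ye xy wT.
Qed.

Lemma joins_cat x es1 y es2 z :
  joins x es1 y -> joins y es2 z -> joins x (es1 ++ es2) z.
Proof.
move=> [T1 w1 <-] [T2 w2 <-]; exists (T1 ++ T2); last by rewrite /dart_edges map_cat.
by apply/dart_walk_cat; exists y.
Qed.

Lemma joins1 x e y : x \in vset e -> y \in vset e -> x != y -> joins x [:: e] y.
Proof. by move=> *; apply: joins_cons (joins0 _). Qed.

Lemma joins_rev x es y : joins x es y -> joins y (rev es) x.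
Proof.
move=> [T + <-]; elim: T x => [|[[u e] v] T IH] x /=.
  by move/eqP->; apply: joins0.
case/and5P=> /eqP-> ue ve uv /IH h; rewrite rev_cons -cats1.
by apply: joins_cat h _; apply: joins1; rewrite // eq_sym.
Qed.

Lemma joins_closed_trail x es : joins x es x -> uniq es ->
  exists2 T, closed_trail T & dart_edges T = es.
Proof.
move=> [T w eT] u; exists T => //; rewrite /closed_trail eT u andbT.
by apply/existsP; exists x.
Qed.

Lemma closed_trail_dart T u f v : closed_trail T -> (u, f, v) \in T ->
  [/\ u \in vset f, v \in vset f, u != v &
   exists2 es, joins v es u & perm_eq (f :: es) (dart_edges T)].
Proof.
case/andP=> /existsP[x w] _ dT; case/splitPr: dT w => T1 T2 w.
case/dart_walk_cat: w => z w1 /= /and5P[/eqP zu -> -> -> w2]; split=> //.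
exists (dart_edges T2 ++ dart_edges T1).
  by apply: (@joins_cat _ _ x); [exists T2 | exists T1; rewrite -?zu].
by rewrite /dart_edges map_cat /=; apply/permP => a; rewrite /= !count_cat /=; lia.
Qed.

(** Two darts cut a closed trail into [f], a piece [es1], [g] and a piece [es2], up to rotation.
    Most reroutings below reverse one of the pieces. *)
Lemma closed_trail_darts2 T u f v x g y : closed_trail T ->
  (u, f, v) \in T -> (x, g, y) \in T -> f != g ->
  exists es1 es2, [/\ joins v es1 x, joins y es2 u &
    perm_eq (f :: g :: es1 ++ es2) (dart_edges T)].
Proof.
case/andP=> /existsP[z w] _ dT; case/splitPr: dT w => T1 T2 w.
case/dart_walk_cat: w => z' w1 /= /and5P[/eqP zu uf vf uv w2] gT fg.
subst z'; have {gT}: (x, g, y) \in T2 \/ (x, g, y) \in T1.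
  move: gT; rewrite mem_cat inE => /or3P[|/eqP[_ gf _]|]; try by [left|right].
  by rewrite gf eqxx in fg.
case=> gT; case/splitPr: gT w1 w2 => T3 T4 w1 w2.
- case/dart_walk_cat: w2 => z' w3 /= /and5P[/eqP E xg yg xy w4]; subst z'.
  exists (dart_edges T3), (dart_edges T4 ++ dart_edges T1); split.
  + by exists T3.
  + by apply: (@joins_cat _ _ z); [exists T4 | exists T1].
  + rewrite /dart_edges !(map_cat, map_cons); apply/permP => a.
    by rewrite /= !(count_cat, map_cat) /= ?count_cat /=; lia.
- case/dart_walk_cat: w1 => z' w3 /= /and5P[/eqP E xg yg xy w4]; subst z'.
  exists (dart_edges T2 ++ dart_edges T3), (dart_edges T4); split.
  + by apply: (@joins_cat _ _ z); [exists T2 | exists T3].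
  + by exists T4.
  + rewrite /dart_edges !(map_cat, map_cons); apply/permP => a.
    by rewrite /= !(count_cat, map_cat) /= ?count_cat /=; lia.
Qed.

Lemma dart_edgesP T f :
  reflect (exists u v, (u, f, v) \in T) (f \in dart_edges T).
Proof.
apply: (iffP mapP) => [[[[u e] v] dT /= ->]|[u [v dT]]]; first by exists u, v.
by exists (u, f, v).
Qed.

(** Trails have at most [#|E|] darts. The predicate is left general because for triples it also asks
    for an even choice on the complement. *)
Lemma longest_trail (P : pred (seq dart)) : P [::] ->
  (forall T, P T -> uniq (dart_edges T)) ->
  exists2 T, P T & forall T', P T' -> size T' <= size T.
Proof.
move=> P0 Pu.
pose Q n := [exists t : n.-tuple dart, P t].
have QP T : P T -> Q (size T) by move=> PT; apply/existsP; exists (in_tuple T).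
have exQ : exists n, Q n by exists 0; apply: (QP _ P0).
have leQ n : Q n -> n <= #|E|.
  case/existsP=> t /Pu ut.
  by rewrite -(size_tuple t) -(size_map (fun d => d.1.2)) -(card_uniqP ut) max_card.
case: (ex_maxnP exQ leQ) => n /existsP[t Pt] nmax.
by exists t => // T' /QP /nmax; rewrite size_tuple.
Qed.

Lemma closed_trail_Euler T : closed_trail T -> 0 < #|E| ->
  (forall e, e \in dart_edges T) -> has_Euler_tour H.
Proof.
case/andP=> /existsP[x w] u E0 all; pose s := [seq (d.1.2, d.2) | d <- T].
have es : walk_edges s = dart_edges T by rewrite /walk_edges /unzip1 /s -map_comp.
have ws : forall y z, dart_walk y T z -> walk y s /\ z = walk_end y s.
  rewrite /s; elim: (T) => [|[[a e] b] T' IH] y z /=; first by move/eqP.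
  case/and5P=> /eqP-> -> -> -> /IH[h1 h2]; split=> //; by rewrite h2.
have [w1 w2] := ws _ _ w; exists x, s; split.
- by split=> //; rewrite es.
(* Length at least two: the empty trail misses an edge, and a single dart cannot return to its entry
   vertex. *)
- split=> //; case: T => [|[[a e] b] [|? ?]] // in w all s {es ws u w1 w2} *.
    by case/card_gt0P: E0 => e _; have := all e.
  move: w => /= /and5P[/eqP-> _ _ ab /eqP ba]; by rewrite ba eqxx in ab.
- by move=> e; rewrite es count_uniq_mem // all.
Qed.

End Trails.

Ltac perm_count :=
  let a := fresh "a" in
  apply/permP => a;
  repeat match goal with h : is_true (perm_eq _ _) |- _ =>
    move/permP/(_ a): h end;
  rewrite ?(count_cat, count_rev) /=
          ?(count_cat, count_rev) /= ?(count_cat, count_rev) /=; clear; lia.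

(** * Edges of size at least four *)

Section LongestTrail.
Variable H : hypergraph.
Local Notation V := (vertex H).
Local Notation E := (edge H).
Variable T : seq (dart H).
Hypothesis cT : closed_trail T.
Hypothesis Tmax : forall T' : seq (dart H), closed_trail T' -> size T' <= size T.
Local Notation F := (dart_edges T).

Lemma longest_no_extension e x es :
  e \notin F -> joins x es x -> perm_eq es (e :: F) -> False.
Proof.
move=> eF j p; have u : uniq es.
  by rewrite (perm_uniq p) /= eF; case/andP: cT.
have [T' cT' eT'] := joins_closed_trail j u.
have := Tmax cT'; rewrite -(size_map (fun d => d.1.2) T').
by rewrite -/(dart_edges T') eT' (perm_size p) /= size_map ltnn.
Qed.

(** Otherwise [u f v] could be replaced by [u e x f v] or by [u f x e v]. *)
Lemma longest_no_insertion e f u v x : e \notin F ->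
  (u, f, v) \in T -> x \in vset e -> x \in vset f -> x != u -> x != v ->
  (u \notin vset e) && (v \notin vset e).
Proof.
move=> eF d xe xf xu xv; have [uf vf uv [es j p]] := closed_trail_dart cT d.
apply/andP; split; apply/negP => he; apply: (longest_no_extension eF).
- apply: (@joins_cons _ u e x) => //; first by rewrite eq_sym.
  by apply: (@joins_cons _ x f v) => //; exact: j.
- by perm_count.
- apply: (@joins_cons _ u f x) => //; first by rewrite eq_sym.
  by apply: (@joins_cons _ x e v) => //; exact: j.
- by perm_count.
Qed.

(** The edge [e] can take over the passage [u f v]; the freed [f] would then be inserted into
    [x g y] at [z]. *)
Lemma longest_no_exchange e f g u v x y z : e \notin F ->
  (u, f, v) \in T -> (x, g, y) \in T -> f != g ->
  u \in vset e -> v \in vset e ->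
  z \in vset f -> z \in vset g -> z != x -> z != y ->
  (x \notin vset f) && (y \notin vset f).
Proof.
move=> eF d d' fg ue ve zf zg zx zy.
have [uf vf uv _] := closed_trail_dart cT d.
have [xg yg xy _] := closed_trail_dart cT d'.
have [es1 [es2 [j1 j2 p]]] := closed_trail_darts2 cT d d' fg.
apply/andP; split; apply/negP => h; apply: (longest_no_extension eF).
- apply: (@joins_cons _ u e v) => //; apply: joins_cat j1 _.
  apply: (@joins_cons _ x f z) => //; first by rewrite eq_sym.
  by apply: (@joins_cons _ z g y) => //; exact: j2.
- by perm_count.
- apply: (@joins_cons _ u e v) => //; apply: joins_cat j1 _.
  apply: (@joins_cons _ x g z) => //; first by rewrite eq_sym.
  by apply: (@joins_cons _ z f y) => //; exact: j2.
- by perm_count.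
Qed.

(* The tour [x g1 u P y g2 u Q x] is rerouted as                                *)
(* [p g1 x Q^-1 u P y g2 q e p].                                                *)
Lemma longest_no_swap e g1 g2 u x y p q : e \notin F -> g1 != g2 ->
  (x, g1, u) \in T /\ (y, g2, u) \in T \/ (u, g1, x) \in T /\ (u, g2, y) \in T ->
  p \in vset g1 -> p \in vset e -> q \in vset g2 -> q \in vset e ->
  p != q -> p != x -> q != y -> False.
Proof.
move=> eF g12 dd pg pe qg qe pq px qy; case: dd => -[d1 d2].
- have [xg ug _ _] := closed_trail_dart cT d1.
  have [yg ug2 _ _] := closed_trail_dart cT d2.
  have [es1 [es2 [j1 j2 pm]]] := closed_trail_darts2 cT d1 d2 g12.
  apply: (longest_no_extension eF).
    apply: (@joins_cons _ p g1 x) => //; apply: joins_cat (joins_rev j2) _.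
    apply: joins_cat j1 _; apply: (@joins_cons _ y g2 q) => //.
      by rewrite eq_sym.
    by apply: (@joins1 _ q e p); rewrite // eq_sym.
  by perm_count.
- have [ug xg _ _] := closed_trail_dart cT d1.
  have [ug2 yg _ _] := closed_trail_dart cT d2.
  have [es1 [es2 [j1 j2 pm]]] := closed_trail_darts2 cT d1 d2 g12.
  apply: (longest_no_extension eF).
    apply: (@joins_cons _ p g1 x) => //; apply: joins_cat j1 _.
    apply: joins_cat (joins_rev j2) _; apply: (@joins_cons _ y g2 q) => //.
      by rewrite eq_sym.
    by apply: (@joins1 _ q e p); rewrite // eq_sym.
  by perm_count.
Qed.

End LongestTrail.

Lemma superset_card (V : finType) (S : {set V}) n :
  #|S| <= n <= #|V| -> exists2 S' : {set V}, S \subset S' & #|S'| = n.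
Proof.
case/andP=> Sn nV; pose r := take (n - #|S|) (enum (~: S)).
have ur : uniq r by rewrite take_uniq // enum_uniq.
exists (S :|: [set x in r]); first exact: subsetUl.
rewrite cardsU (_ : S :&: _ = set0); last first.
  apply/setP => x; rewrite !inE; apply/negP => /andP[xS /mem_take].
  by rewrite mem_enum inE xS.
rewrite cards0 subn0 cardsE (card_uniqP ur) size_take -cardE.
by have := cardsC S; case: ifP; lia.
Qed.

(** * Longest closed trails in covering hypergraphs with [k >= 4] *)

Section Covering.
Variables (k : nat) (H : hypergraph).
Hypothesis k3 : 3 <= k.
Hypothesis hH : covering_hypergraph k H.
Local Notation V := (vertex H).
Local Notation E := (edge H).

Lemma card_edge (e : E) : #|vset e| = k.
Proof. by case: hH. Qed.

Lemma covering_subset (S : {set V}) : #|S| < k -> exists e, S \subset vset e.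
Proof.
move=> Sk; case: hH => un /card_gt0P[e0 _] cov.
have kV : k <= #|V| by rewrite -(un e0) max_card.
have [|S' sub /cov[e S'e]] := @superset_card V S (k - 1); first by (move: Sk k3 kV; clear; lia).
by exists e; exact: subset_trans S'e.
Qed.

(** Take a pair with largest intersection [I]. If [I] is too small, [I] with one vertex from each
    difference still lies in some edge [g], and [g] paired with [e] or with [f] does better. *)
Lemma close_pair (F : {set E}) e0 f0 : e0 \notin F -> f0 \in F ->
  exists e f, [/\ e \notin F, f \in F & k - 2 <= #|vset e :&: vset f|].
Proof.
move=> eF fF; pose P (d : E * E) := (d.1 \notin F) && (d.2 \in F).
have P0 : P (e0, f0) by rewrite /P eF.
case: (arg_maxnP (fun d => #|vset d.1 :&: vset d.2|) P0) => -[e f] /andP[/= he hf] mx.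
exists e, f; split=> //; rewrite leqNgt; apply/negP => lt.
set I := vset e :&: vset f in lt mx.
have e_f : 0 < #|vset e :\: vset f| by rewrite cardsD card_edge -/I; (move: lt k3; clear; lia).
have f_e : 0 < #|vset f :\: vset e|.
  by rewrite cardsD card_edge setIC -/I; (move: lt k3; clear; lia).
case/card_gt0P: e_f => p /setDP[pe pf]; case/card_gt0P: f_e => q /setDP[qf qe].
have pI : p \notin I by rewrite inE (negPf pf) andbF.
have qI : q \notin I by rewrite inE (negPf qe).
have [|g /subsetP gS] := @covering_subset (p |: (q |: I)).
  by rewrite cardsU1 [#|q |: I|]cardsU1 qI; case: (_ \notin _) => /=; (move: lt k3; clear; lia).
have Ig x : x \in I -> x \in vset g by move=> xI; apply: gS; rewrite !inE -in_setI -/I xI !orbT.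
have [gF|gF] := boolP (g \in F).
- have /mx : P (e, g) by rewrite /P he.
  apply/negP; rewrite -ltnNge /=; apply: (@leq_trans #|p |: I|).
    by rewrite cardsU1 pI.
  apply/subset_leq_card/subsetP => x /setU1P[->|xI]; rewrite inE.
    by rewrite pe gS // !inE eqxx.
  by rewrite Ig // andbT; case/setIP: xI.
- have /mx : P (g, f) by rewrite /P gF.
  apply/negP; rewrite -ltnNge /=; apply: (@leq_trans #|q |: I|).
    by rewrite cardsU1 qI.
  apply/subset_leq_card/subsetP => x /setU1P[->|xI]; rewrite inE.
    by rewrite qf gS // !inE eqxx orbT.
  by rewrite Ig //; case/setIP: xI.
Qed.

Section Longest.
Hypothesis k4 : 4 <= k.
Variable T : seq (dart H).
Hypothesis cT : closed_trail T.
Hypothesis Tmax : forall T' : seq (dart H), closed_trail T' -> size T' <= size T.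
Local Notation F := (dart_edges T).

Lemma longest_anchor_in e f u v : e \notin F -> (u, f, v) \in T ->
  (u \in vset e) || (v \in vset e) -> vset e :&: vset f \subset [set u; v].
Proof.
move=> eF d uv; apply/subsetP => x /setIP[xe xf]; rewrite !inE.
apply: contraLR uv; rewrite !negb_or => /andP[xu xv].
exact: (longest_no_insertion cT Tmax eF d xe xf).
Qed.

(** If an end of [f] lies in [e], the intersection is contained in [{u, v}], so [k = 4] and it
    equals [{u, v}]. An edge through [u], a vertex [a] of [f] alone and a vertex [p] of [e] alone
    then replaces [f]; otherwise an insertion or exchange would be possible. *)
Lemma longest_free_pair e f : e \notin F -> f \in F ->
  k - 2 <= #|vset e :&: vset f| ->
  exists f' u v, [/\ (u, f', v) \in T, k - 2 <= #|vset e :&: vset f'|,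
                     u \notin vset e & v \notin vset e].
Proof.
move=> eF /dart_edgesP[u [v d]] I2.
have [uve|] := boolP ((u \in vset e) || (v \in vset e)); last first.
  by rewrite negb_or => /andP[ue ve]; exists f, u, v.
have sub := longest_anchor_in eF d uve.
have [uf vf uv _] := closed_trail_dart cT d.
have I2' := subset_leq_card sub; rewrite cards2 uv /= in I2'.
have Ik : k = 4 by (move: I2 I2' k4; clear; lia).
have/eqP Iuv : vset e :&: vset f == [set u; v].
  by rewrite eqEcard sub cards2 uv /=; (move: I2 Ik; clear; lia).
have [ue _] : u \in vset e /\ u \in vset f.
  by apply/setIP; rewrite Iuv !inE eqxx.
have [ve _] : v \in vset e /\ v \in vset f.
  by apply/setIP; rewrite Iuv !inE eqxx orbT.
have : 0 < #|vset e :\: vset f| by rewrite cardsD card_edge Iuv cards2 uv Ik.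
have : 0 < #|vset f :\: vset e| by rewrite cardsD card_edge setIC Iuv cards2 uv Ik.
case/card_gt0P=> a /setDP[af ae] /card_gt0P[p /setDP[pe pf]].
have [|g /subsetP gS] := @covering_subset [set u; a; p].
  rewrite Ik; apply: leq_ltn_trans (leq_card_setU _ _) _.
  by rewrite cards1 cards2; case: (_ != _).
have ug : u \in vset g by apply: gS; rewrite !inE eqxx.
have ag : a \in vset g by apply: gS; rewrite !inE eqxx orbT.
have pg : p \in vset g by apply: gS; rewrite !inE eqxx !orbT.
have au : a != u by apply: contraNneq ae => ->.
have av : a != v by apply: contraNneq ae => ->.
have ap : a != p by apply: contraNneq ae => ->.
have up : u != p by apply: contraNneq pf => <-.
have [gF|gF] := boolP (g \in F); last first.
  by have := longest_no_insertion cT Tmax gF d ag af au av; rewrite ug.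
case/dart_edgesP: gF => s [t d'].
have [st|] := boolP ((s \in vset e) || (t \in vset e)); last first.
  rewrite negb_or => /andP[se te]; exists g, s, t; split=> //.
  rewrite Ik; apply: (@leq_trans #|[set u; p]|); first by rewrite cards2 up.
  by apply/subset_leq_card/subsetP => x /set2P[]->; rewrite inE ?ue ?pe.
have sub' := subsetP (longest_anchor_in eF d' st).
have /sub' : u \in vset e :&: vset g by rewrite inE ue.
have /sub' : p \in vset e :&: vset g by rewrite inE pe.
have fg : f != g by apply: contraNneq pf => ->.
move=> /set2P pst /set2P ust.
have [as_ at_] : a != s /\ a != t.
  by split; case: pst ust => <- [] e1; rewrite -?e1 // e1 eqxx in up *.
have := longest_no_exchange cT Tmax eF d d' fg ue ve af ag as_ at_.
by case: ust => <-; rewrite uf ?andbF.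
Qed.

Lemma longest_covers e : 0 < size T -> e \in F.
Proof.
move=> T0; apply: contraT => eF0.
have [f0 f0F] : exists f, f \in F.
  by case: (T) T0 => // -[[u f] v] T' _; exists f; rewrite inE eqxx.
have [||e1 [f1 []]] := @close_pair [set f in F] e f0; rewrite ?inE // => e1F.
move=> f1F I1; have {e f0 f0F eF0 T0} := e1F.
move: (e1) I1 {e1F} => e I1 eF.
have [f [u [v [d I2 ue ve]]]] := longest_free_pair eF f1F I1.
have [uf vf uv _] := closed_trail_dart cT d.
pose A := vset f :\: [set u; v].
have cA : #|A| = k - 2.
  rewrite cardsD card_edge (setIidPr _) ?cards2 ?uv //.
  by apply/subsetP => x /set2P[]->.
have AI : A = vset e :&: vset f.
  apply/esym/eqP; rewrite eqEcard cA I2 andbT; apply/subsetP => x /setIP[xe xf].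
  rewrite !inE xf andbT negb_or.
  by apply/andP; split; [apply: contraNneq ue|apply: contraNneq ve] => <-.
have Ae x : x \in A -> x \in vset e by rewrite AI => /setIP[].
have Af x : x \in A -> [/\ x \in vset f, x != u & x != v].
  by rewrite !inE negb_or => /andP[/andP[-> ->] ->].
have /card_gt1P[p [q [/setDP[pe pA] /setDP[qe qA] pq]]] : 1 < #|vset e :\: A|.
  rewrite cardsD card_edge (setIidPr _) ?cA; first by (move: k4; clear; lia).
  by apply/subsetP.
have npf x : x \in vset e -> x \notin A -> x \notin vset f.
  by move=> xe; rewrite AI inE xe.
have /card_gt0P[a0 a0A] : 0 < #|A| by (move: cA k4; clear; lia).
(* Dropping [a0] leaves room for [u] and a vertex [r] of [e] in a [(k - 1)]-set, and [k >= 4] still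
   leaves some [a] in [A']. *)
pose A' := A :\ a0.
have cA' : #|A'| = k - 3 by have := cardsD1 a0 A; rewrite a0A -/A'; (move: cA k4; clear; lia).
have /card_gt0P[a aA'] : 0 < #|A'| by (move: cA' k4; clear; lia).
have sA' x : x \in A' -> x \in A by case/setD1P.
have aA := sA' _ aA'; have [af au av] := Af _ aA.
have key r : r \in vset e -> r \notin A -> exists g z,
    [/\ r \in vset g, (z, g, u) \in T \/ (u, g, z) \in T, z \notin vset e, g != f
      & {subset A' <= vset g}].
  move=> re rA; have rf := npf _ re rA.
  have [|g /subsetP gS] := @covering_subset (u |: (r |: A')).
    by rewrite cardsU1 [#|r |: _|]cardsU1 cA'; do 2 case: (_ \notin _) => /=; (move: k4; clear; lia).
  have ug : u \in vset g by apply: gS; rewrite !inE eqxx.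
  have rg : r \in vset g by apply: gS; rewrite !inE eqxx orbT.
  have A'g x : x \in A' -> x \in vset g.
    by move=> xA'; apply: gS; rewrite in_setU1 in_setU1 xA' !orbT.
  have ag := A'g _ aA'.
  have gf : g != f by apply: contraNneq rf => <-.
  have [gF|gF] := boolP (g \in F); last first.
    by have := longest_no_insertion cT Tmax gF d ag af au av; rewrite ug.
  case/dart_edgesP: gF => s [t d'].
  have [sg tg st _] := closed_trail_dart cT d'.
  have rA' : r \notin A' by apply: contra rA => /sA'.
  have subI : r |: A' \subset vset e :&: vset g.
    by apply/subsetP => x /setU1P[->|xA']; rewrite inE ?re ?rg // Ae ?A'g ?sA'.
  have [ste|] := boolP ((s \in vset e) || (t \in vset e)).
    (* The [k - 2 >= 2] vertices of [r |: A'] must be exactly the ends of [g]. So [e] can replace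
       [g], and [g] can be inserted into [f] at [a]. *)
    have sub := longest_anchor_in eF d' ste.
    have cs := subset_leq_card (subset_trans subI sub).
    rewrite cardsU1 rA' cA' cards2 st /= in cs.
    have ers : r |: A' = [set s; t].
      by apply/eqP; rewrite eqEcard (subset_trans subI sub) cards2 st cardsU1 rA' cA' /=; (move: cs k4; clear; lia).
    have inI x : x \in [set s; t] -> x \in vset e.
      by rewrite -ers => /(subsetP subI)/setIP[].
    have se : s \in vset e by apply: inI; rewrite !inE eqxx.
    have te : t \in vset e by apply: inI; rewrite !inE eqxx orbT.
    have := longest_no_exchange cT Tmax eF d' d gf se te ag af au av.
    by rewrite ug.
  rewrite negb_or => /andP[se te].
  (* Besides [u] and the [k - 2] vertices of [r |: A'], the edge [g] has one more vertex. Both [s]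
     and [t] avoid [e], so one of them is [u]. *)
  have only x : x \in vset g -> x \notin vset e -> x != u ->
      forall y, y \in vset g -> y \notin vset e -> y != u -> y = x.
    move=> xg xe xu y yg ye yu; apply/eqP/contraT => yx.
    have sub4 : y |: (x |: (u |: (r |: A'))) \subset vset g.
      apply/subsetP => z /setU1P[->//|/setU1P[->//|/setU1P[->//|]]].
      by move/(subsetP subI)/setIP=> [].
    have := subset_leq_card sub4; rewrite card_edge.
    have ne z z' : z \in vset e -> z' \notin vset e -> z' != z.
      by move=> ze; apply: contraNneq => ->.
    have nA z : z \notin vset e -> z \notin A' by apply: contra => /sA'/Ae.
    have c1 : u \notin r |: A' by rewrite !in_setU1 negb_or ne ?nA.
    have c2 : x \notin u |: (r |: A') by rewrite !in_setU1 !negb_or xu ne ?nA.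
    have c3 : y \notin x |: (u |: (r |: A')).
      by rewrite !in_setU1 !negb_or yx yu ne ?nA.
    rewrite (cardsU1 y) c3 (cardsU1 x) c2 (cardsU1 u) c1 (cardsU1 r) rA' cA'.
    by move: k4; clear; lia.
  have [su|su] := eqVneq s u.
    by exists g, t; split=> //; right; rewrite -su.
  have [tu|tu] := eqVneq t u.
    by exists g, s; split=> //; left; rewrite -tu.
  by rewrite (only _ sg se su _ tg te tu) eqxx in st.
have [g1 [z1 [pg1 d1 ze1 g1f sg1]]] := key p pe pA.
have [g2 [z2 [qg2 d2 ze2 g2f sg2]]] := key q qe qA.
have [pa qa] : p != a /\ q != a.
  by split; [apply: contraNneq pA | apply: contraNneq qA] => ->.
have ae := Ae _ aA.
have ne z z' : z \in vset e -> z' \notin vset e -> z != z'.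
  by move=> ze; apply: contraNneq => <-.
have g12 : g1 != g2.
  apply/eqP => g12; rewrite -g12 in qg2.
  have [ug zg zu] : [/\ u \in vset g1, z1 \in vset g1 & z1 != u].
    by case: d1 => /(closed_trail_dart cT)[? ? ? _]; split; rewrite // eq_sym.
  have : z1 |: (u |: (q |: (p |: A'))) \subset vset g1.
    apply/subsetP => x; rewrite !in_setU1.
    by case/or4P=> [/eqP->|/eqP->|/eqP->|/orP[/eqP->|/sg1]].
  move/subset_leq_card; rewrite card_edge.
  have nA z : z \notin vset e -> z \notin A' by apply: contra => /sA'/Ae.
  have nA' z : z \notin A -> z \notin A' by apply: contra => /sA'.
  have ne' z z' : z \in vset e -> z' \notin vset e -> z' != z.
    by move=> ze z'e; rewrite eq_sym ne.
  have c1 : q \notin p |: A' by rewrite !in_setU1 negb_or nA' // eq_sym pq.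
  have c2 : u \notin q |: (p |: A') by rewrite !in_setU1 !negb_or !ne' ?nA.
  have c3 : z1 \notin u |: (q |: (p |: A')).
    by rewrite !in_setU1 !negb_or zu !ne' ?nA.
  rewrite (cardsU1 z1) c3 (cardsU1 u) c2 (cardsU1 q) c1 (cardsU1 p) nA' // cA'.
  by move: k4; clear; lia.
have sw := longest_no_swap cT Tmax eF.
(* Since [f] leaves [u], either [g1] and [g2] both enter [u], or one of them leaves [u] as [f]
   does. *)
case: d1 d2 => d1 [] d2; exfalso.
- exact: sw g12 (or_introl (conj d1 d2)) pg1 pe qg2 qe pq (ne _ _ pe ze1)
    (ne _ _ qe ze2).
- exact: sw g2f (or_intror (conj d2 d)) qg2 qe af ae qa (ne _ _ qe ze2) av.
- exact: sw g1f (or_intror (conj d1 d)) pg1 pe af ae pa (ne _ _ pe ze1) av.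
- exact: sw g12 (or_intror (conj d1 d2)) pg1 pe qg2 qe pq (ne _ _ pe ze1)
    (ne _ _ qe ze2).
Qed.
End Longest.

Lemma Euler_tour_ge4 : 4 <= k -> 2 <= #|E| -> has_Euler_tour H.
Proof.
move=> k4 E2; have [x0 _] := card_gt0P (vertex_nonempty H).
have [|T /andP[_ u] //|T cT Tmax] := @longest_trail H (@closed_trail H).
  by rewrite /closed_trail andbT; apply/existsP; exists x0 => /=.
suff T0 : 0 < size T.
  by apply: (closed_trail_Euler cT) => [|e]; [(move: E2; clear; lia) | exact: longest_covers].
(* Two edges with two common vertices form a closed trail of length two, so a longest one is not
   empty. *)
have /card_gt1P[e0 [f0 [_ _ ef]]] : 1 < #|E| by [].
have [||e [f [eF fF I2]]] := @close_pair [set f0] e0 f0; rewrite ?inE //.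
have /card_gt1P[x [y [/setIP[xe xf] /setIP[ye yf] xy]]] :
  1 < #|vset e :&: vset f| by (move: I2 k4; clear; lia).
have j : joins x [:: e; f] x.
  by apply: (joins_cons xe ye xy); apply: (joins1 yf xf); rewrite eq_sym.
have [|T' cT' eT'] := joins_closed_trail j.
  by rewrite /= inE andbT; apply: contra eF => /eqP->.
have := Tmax _ cT'; rewrite -(size_map (fun d => d.1.2) T').
by rewrite -/(dart_edges T') eT'; apply: leq_trans.
Qed.
End Covering.

(** * Choices of a spare vertex in each triple *)

Section Choices.
Variable H : hypergraph.
Local Notation V := (vertex H).
Local Notation E := (edge H).
Implicit Types (w : {ffun E -> V}) (R : {set E}) (B : {set V}).

(* In a 3-uniform hypergraph a tour uses two of the vertices of each edge; a      *)
(* choice [w] records the spare one, the other two being the anchors of the edge. *)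
Definition choice_fun w := [forall e, w e \in vset e].

Definition anchored w e v := (v \in vset e) && (v != w e).

(** The degree of [v] modulo two in the multigraph whose edges join the two anchors of each member
    of [R]. *)
Definition parity R w v := \big[addb/false]_(e in R) anchored w e v.

Definition update w e b : {ffun E -> V} :=
  [ffun e' => if e' == e then b else w e'].

Definition flip R w p q := exists2 w', choice_fun w' &
  forall v, parity R w' v = parity R w v (+) (v == p) (+) (v == q).

(* Moving the choice on [e] between [a] and [b] flips the parities at [a], [b]. *)
Definition slides w e a b :=
  [&& a \in vset e, b \in vset e, a != b & (w e == a) || (w e == b)].

Lemma choice_funP w e : choice_fun w -> w e \in vset e.
Proof. by move/forallP. Qed.

Lemma slidesC w e a b : slides w e a b = slides w e b a.
Proof. by rewrite /slides andbCA [a == b]eq_sym orbC. Qed.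

Lemma flipC R w p q : flip R w p q -> flip R w q p.
Proof. by case=> w' cw' h; exists w' => // v; rewrite h addbAC. Qed.

(** There are finitely many choices, so the existence of a flip is decidable; this licenses the
    proof of [flip_exists] by contradiction. *)
Lemma flip_stable R w p q : ~ ~ flip R w p q -> flip R w p q.
Proof.
pose b := [exists w', choice_fun w' &&
  [forall v, parity R w' v == parity R w v (+) (v == p) (+) (v == q)]].
have flipP : reflect (flip R w p q) b.
  apply: (iffP existsP) => [[w' /andP[cw' /forallP h]]|[w' cw' h]]; exists w' => //.
    by move=> v; apply/eqP.
  by rewrite cw'; apply/forallP => v; apply/eqP.
by move=> nn; apply/flipP/contraT => /flipP.
Qed.

Lemma update_choice w e b : choice_fun w -> b \in vset e ->
  choice_fun (update w e b).
Proof.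
move=> cw be; apply/forallP => e'; rewrite ffunE.
by case: eqP => [->|_] //; apply: choice_funP.
Qed.

Lemma parityD1 R w e v : e \in R ->
  parity R w v = anchored w e v (+) parity (R :\ e) w v.
Proof.
move=> eR; rewrite /parity (bigD1 e) //=; congr addb.
by apply: eq_bigl => e'; rewrite !inE andbC.
Qed.

Lemma parity_update R w e b v : choice_fun w -> e \in R -> b \in vset e ->
  parity R (update w e b) v = parity R w v (+) (v == w e) (+) (v == b).
Proof.
move=> cw eR be; rewrite !(@parityD1 R _ e) //.
have -> : parity (R :\ e) (update w e b) v = parity (R :\ e) w v.
  apply: eq_bigr => e' /setD1P[ee' _].
  by rewrite /anchored ffunE (negPf ee').
rewrite /anchored ffunE eqxx; have we := choice_funP e cw.
case: (boolP (v \in vset e)) => ve /=.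
  by case: (v == b); case: (v == w e); case: (parity _ _ _).
have -> : (v == w e) = false by apply: contraNF ve => /eqP->.
by have -> : (v == b) = false by [apply: contraNF ve => /eqP->]; rewrite !addbF.
Qed.

Lemma slides_update R w e a b : choice_fun w -> e \in R -> slides w e a b ->
  exists w', [/\ choice_fun w', forall e', e' != e -> w' e' = w e' &
    forall v, parity R w' v = parity R w v (+) (v == a) (+) (v == b)].
Proof.
move=> cw eR /and4P[ae be ab /orP[/eqP wa|/eqP wb]].
- exists (update w e b); split=> [|e' ee'|v]; first exact: update_choice.
    by rewrite ffunE (negPf ee').
  by rewrite parity_update // wa.
- exists (update w e a); split=> [|e' ee'|v]; first exact: update_choice.
    by rewrite ffunE (negPf ee').
  by rewrite parity_update // wb addbAC.
Qed.

Lemma flip1 R w e a b : choice_fun w -> e \in R -> slides w e a b -> flip R w a b.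
Proof. by move=> cw eR /(slides_update cw eR)[w' [cw' _ h]]; exists w'. Qed.

(** The two changes at [b] cancel. As the edges differ, the first move leaves the second
    available. *)
Lemma flip2 R w e1 e2 a b c : choice_fun w -> e1 \in R -> e2 \in R -> e1 != e2 ->
  slides w e1 a b -> slides w e2 b c -> flip R w a c.
Proof.
move=> cw e1R e2R e12 /(slides_update cw e1R)[w1 [cw1 h1 p1]] s2.
have /(flip1 cw1 e2R)[w' cw' p2] : slides w1 e2 b c by rewrite /slides h1 // eq_sym.
by exists w' => // v; rewrite p2 p1 addbK.
Qed.

Lemma flip3 R w e1 e2 e3 a b c d : choice_fun w ->
  e1 \in R -> e2 \in R -> e3 \in R -> e1 != e2 -> e1 != e3 -> e2 != e3 ->
  slides w e1 a b -> slides w e2 b c -> slides w e3 c d -> flip R w a d.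
Proof.
move=> cw e1R e2R e3R e12 e13 e23 /(slides_update cw e1R)[w1 [cw1 h1 p1]] s2 s3.
have s2' : slides w1 e2 b c by rewrite /slides h1 // eq_sym.
have s3' : slides w1 e3 c d by rewrite /slides h1 // eq_sym.
have [w' cw' p2] := flip2 cw1 e2R e3R e23 s2' s3'.
by exists w' => // v; rewrite p2 p1 addbK.
Qed.

Lemma third_vertex (e : E) a b : #|vset e| = 3 -> a \in vset e -> b \in vset e ->
  a != b -> exists c, [/\ c \in vset e, c != a, c != b &
    forall v, v \in vset e -> [\/ v = a, v = b | v = c]].
Proof.
move=> e3 ae be ab.
have sub : [set a; b] \subset vset e by apply/subsetP => v /set2P[]->.
have c1 : #|vset e :\: [set a; b]| = 1.
  by rewrite cardsD (setIidPr sub) cards2 ab e3.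
have/eqP/cards1P[c ec] := c1; exists c.
have : c \in vset e :\: [set a; b] by rewrite ec set11.
rewrite !inE negb_or => /andP[/andP[-> ->] ->]; split=> // v ve.
have [/set2P[]->|vab] := boolP (v \in [set a; b]); try by [constructor 1|constructor 2].
by constructor 3; apply/set1P; rewrite -ec inE vab.
Qed.

Lemma edge3_eq (e : E) a b c d : #|vset e| = 3 ->
  a \in vset e -> b \in vset e -> c \in vset e -> d \in vset e ->
  uniq [:: a; b; c] -> [|| d == a, d == b | d == c].
Proof.
move=> e3 ae be ce de; rewrite /= !inE negb_or andbT => /andP[/andP[ab ac] bc].
have [z [_ _ _ h]] := third_vertex e3 ae be ab.
case: (h c ce) => [E|E|->]; try by rewrite E eqxx in ac bc.
by case: (h d de) => ->; rewrite eqxx ?orbT.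
Qed.

End Choices.

Lemma injective_rel_card (I J : finType) (X : {set I}) (Y : {set J})
    (r : I -> J -> bool) :
  (forall u, u \in X -> exists2 v, v \in Y & r u v) ->
  (forall u u' v, u \in X -> u' \in X -> v \in Y -> r u v -> r u' v -> u = u') ->
  #|X| <= #|Y| /\ (#|Y| <= #|X| -> forall v, v \in Y -> exists2 u, u \in X & r u v).
Proof.
move=> ex inj; pose f := [ffun u => [pick v in Y | r u v]].
have fP u : u \in X -> exists2 v, f u = Some v & (v \in Y) && r u v.
  move=> uX; rewrite ffunE; case: pickP => [v h|h]; first by exists v.
  by have [v vY ruv] := ex u uX; have /andP[] := h v.
have finj : {in X &, injective f}.
  move=> u u' uX u'X; have [v -> /andP[vY ruv]] := fP u uX.
  have [v' -> /andP[_ ruv']] := fP u' u'X.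
  by case=> ev; subst v'; apply: inj ruv ruv'.
have sub : f @: X \subset Some @: Y.
  apply/subsetP => _ /imsetP[u uX ->]; have [v -> /andP[vY _]] := fP u uX.
  exact: imset_f.
have cS : #|Some @: Y| = #|Y| by rewrite card_imset //; exact: Some_inj.
have cX : #|f @: X| = #|X| by rewrite card_in_imset.
split; first by rewrite -cS -cX subset_leq_card.
move=> YX v vY; have /eqP eq : f @: X == Some @: Y by rewrite eqEcard sub cS cX.
have : Some v \in f @: X by rewrite eq imset_f.
case/imsetP=> u uX; have [v' -> /andP[_ ruv]] := fP u uX.
by case=> ->; exists u.
Qed.

(** * Flipping the parities at any two vertices *)

Section Flip.
Variable H : hypergraph.
Local Notation V := (vertex H).
Local Notation E := (edge H).
Variables (R : {set E}) (B : {set V}) (w : {ffun E -> V}).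
Hypothesis cw : choice_fun w.
Hypothesis R3 : forall e, e \in R -> #|vset e| = 3.
Hypothesis RB : forall e, e \in R -> vset e \subset B.
Hypothesis Rcov : forall a b, a \in B -> b \in B -> a != b ->
  exists2 e, e \in R & (a \in vset e) && (b \in vset e).

Definition slidable a b := [exists e in R, slides w e a b].

(* When [x] and [y] cannot be flipped, every triple on [x] and [y] has its third *)
(* vertex [z] chosen; all other vertices turn out to be one-sided.              *)
Definition apex x y z := [exists e in R, [&& x \in vset e, y \in vset e & w e == z]].

Definition one_sided x y :=
  [set v in B | [&& v != x, v != y, ~~ apex x y v, ~~ slidable x v & slidable y v]].

Definition link x v s := [exists e in R, [&& x \in vset e, v \in vset e & w e == s]].

Lemma slidableI e a b : e \in R -> slides w e a b -> slidable a b.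
Proof. by move=> eR s; apply/existsP; exists e; rewrite eR. Qed.

Lemma slidableP a b : reflect (exists2 e, e \in R & slides w e a b) (slidable a b).
Proof. exact: exists_inP. Qed.

Lemma linkP x v s :
  reflect (exists e, [/\ e \in R, x \in vset e, v \in vset e & w e = s]) (link x v s).
Proof.
apply: (iffP exists_inP) => [[e eR /and3P[xe ve /eqP we]]|[e [eR xe ve we]]].
  by exists e.
by exists e => //; rewrite xe ve we eqxx.
Qed.

Lemma apexC x y z : apex x y z = apex y x z.
Proof. by apply: eq_existsb => e; rewrite [(x \in _) && _]andbCA. Qed.

Lemma one_sidedP x y v : reflect [/\ v \in B, v != x, v != y, ~~ apex x y v &
  ~~ slidable x v /\ slidable y v] (v \in one_sided x y).
Proof.
rewrite inE; apply: (iffP andP) => [[vB /and5P[]]|[vB vx vy az [h1 h2]]] //.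
by split=> //; apply/and5P.
Qed.

Section NoFlip.
Variables x y : V.
Hypotheses (xB : x \in B) (yB : y \in B) (xy : x != y).
Hypothesis nf : ~ flip R w x y.

Lemma noflip1 e : e \in R -> ~~ slides w e x y.
Proof. by move=> eR; apply/negP => s; apply: nf; apply: flip1 s. Qed.

Lemma noflip2 e1 e2 a : e1 \in R -> e2 \in R -> slides w e1 x a ->
  slides w e2 a y -> e1 = e2.
Proof.
move=> e1R e2R s1 s2; apply/eqP/contraT => e12; case: nf.
exact: flip2 e12 s1 s2.
Qed.

Lemma noflip3 e1 e2 e3 a b : e1 \in R -> e2 \in R -> e3 \in R ->
  e1 != e2 -> e1 != e3 -> e2 != e3 ->
  slides w e1 x a -> slides w e2 a b -> slides w e3 b y -> False.
Proof.
by move=> e1R e2R e3R e12 e13 e23 s1 s2 s3; apply: nf; apply: flip3 s1 s2 s3.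
Qed.

Lemma apexP z : apex x y z -> exists e, [/\ e \in R, [/\ x \in vset e, y \in vset e,
  z \in vset e & w e = z], z != x /\ z != y & slides w e x z /\ slides w e z y].
Proof.
case/exists_inP=> e eR /and3P[xe ye /eqP we]; exists e.
have ze : z \in vset e by rewrite -we choice_funP.
have [zx zy] : z != x /\ z != y.
  by have := noflip1 eR; rewrite /slides xe ye xy we /= negb_or => /andP.
have s1 : slides w e x z by rewrite /slides xe ze we eqxx eq_sym zx orbT.
have s2 : slides w e z y by rewrite /slides ye ze we eqxx zy.
by split.
Qed.

Lemma apex_slide z e e' : e \in R -> e' \in R -> slides w e x z ->
  x \in vset e' -> y \in vset e' -> w e' = z -> e = e'.
Proof.
move=> eR e'R s xe ye we.
have ze : z \in vset e' by rewrite -we choice_funP.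
have := noflip1 e'R; rewrite {1}/slides xe ye xy we /= negb_or => /andP[zx zy].
by apply: (noflip2 eR e'R s); rewrite /slides ye ze we eqxx zy.
Qed.

Lemma slidable_both v : v != x -> v != y -> slidable x v -> slidable y v ->
  apex x y v.
Proof.
move=> vx vy /slidableP[e eR s] /slidableP[e' e'R s'].
rewrite slidesC in s'; have ee' := noflip2 eR e'R s s'; subst e'.
case/and4P: s s' => xe ve _ wxv /and4P[_ ye _ wvy].
apply/exists_inP; exists e => //; rewrite xe ye /=.
by case/orP: wxv wvy => // /eqP->; rewrite (negPf xy) orbF eq_sym (negPf vx).
Qed.

(** On an edge through [x] and [v] the choice [s] is neither of them, so [s] slides to [x]. It is no
    apex, since its apex edge would be this one and contain [y]; by [slidable_both] it does not
    slide to [y]. *)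
Lemma link_exists v : v \in B -> v != x -> v != y -> ~~ apex x y v ->
  ~~ slidable x v -> exists2 s, s \in one_sided y x & link x v s.
Proof.
move=> vB vx vy nz nxv; have [|g gR /andP[xg vg]] := Rcov xB vB; first by rewrite eq_sym.
have wg := choice_funP g cw.
have ns : ~~ slides w g x v by apply: contra nxv => /(slidableI gR).
move: ns; rewrite /slides xg vg eq_sym vx /= negb_or => /andP[wx wv].
have sl : slides w g x (w g) by rewrite /slides xg wg eqxx eq_sym wx orbT.
have wy : w g != y.
  apply: contra (noflip1 gR) => /eqP wy.
  by rewrite -[X in slides w g x X]wy.
have naz : ~~ apex x y (w g).
  apply/negP => /apexP[e [eR [xe ye _ we] _ _]].
  have ge := apex_slide gR eR sl xe ye we; subst e.
  have u3 : uniq [:: x; v; w g].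
    by rewrite /= !inE negb_or andbT [x == v]eq_sym vx eq_sym wx eq_sym wv.
  have := edge3_eq (R3 gR) xg vg wg ye u3.
  by rewrite eq_sym (negPf xy) eq_sym (negPf vy) eq_sym (negPf wy).
exists (w g); last by apply/linkP; exists g.
have sx := slidableI gR sl.
apply/one_sidedP; split=> //; first exact: (subsetP (RB gR)).
  by rewrite apexC.
by split=> //; apply: contra naz => sy; exact: slidable_both.
Qed.

(** Otherwise [g], [g'] and the edge sliding [v] to [y] form a chain [x], [s], [v], [y]. *)
Lemma link_unique v s g g' : v \in one_sided x y -> g' \in R -> x \in vset g' ->
  v \in vset g' -> w g' = s -> s != x -> s != v -> g \in R -> slides w g x s -> g = g'.
Proof.
move=> /one_sidedP[vB vx vy nz [nxv /slidableP[h hR sh]]] g'R xg vg ws sx sv gR sg.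
apply/eqP/contraT => gg'; have sg' : s \in vset g' by rewrite -ws choice_funP.
have sy : s != y.
  apply: contra (noflip1 g'R) => /eqP sy; rewrite /slides xg xy -sy ws eqxx orbT.
  by rewrite sg'.
have u3 : uniq [:: x; v; s].
  by rewrite /= !inE negb_or andbT [x == v]eq_sym vx eq_sym sx eq_sym sv.
have yng : forall e, e \in R -> x \in vset e -> v \in vset e -> s \in vset e ->
    y \notin vset e.
  move=> e eR xe ve se; apply/negP => ye; have := edge3_eq (R3 eR) xe ve se ye u3.
  by rewrite eq_sym (negPf xy) eq_sym (negPf vy) eq_sym (negPf sy).
have [yh vh] : y \in vset h /\ v \in vset h by case/and4P: sh.
have [xg1 sg1] : x \in vset g /\ s \in vset g by case/and4P: sg.
case: (@noflip3 g g' h s v) => //.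
- apply: contraTneq yh => gh; rewrite -gh; apply: yng => //.
  by rewrite gh.
- by apply: contraTneq yh => <-; apply: yng.
- by rewrite /slides sg' vg sv ws eqxx.
- by rewrite slidesC.
Qed.

Lemma link_inj v v' s : v \in one_sided x y -> v' \in one_sided x y ->
  s \in one_sided y x -> link x v s -> link x v' s -> v = v'.
Proof.
move=> vX v'X /one_sidedP[_ sy sx _ [nys sxs]] /linkP[g [gR xg vg wg]].
move=> /linkP[g' [g'R xg' vg' wg']].
have [vx nxv] : v != x /\ ~~ slidable x v by case/one_sidedP: vX => _ ? _ _ [].
have [vx' nxv'] : v' != x /\ ~~ slidable x v'.
  by case/one_sidedP: v'X => _ ? _ _ [].
have sv : s != v by apply: contraNneq nxv => <-.
have sv' : s != v' by apply: contraNneq nxv' => <-.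
have sg : s \in vset g by rewrite -wg choice_funP.
have sl : slides w g x s by rewrite /slides xg sg wg eqxx eq_sym sx orbT.
have gg' : g = g' := link_unique v'X g'R xg' vg' wg' sx sv' gR sl.
subst g'; have u3 : uniq [:: x; v; s].
  by rewrite /= !inE negb_or andbT [x == v]eq_sym vx eq_sym sx eq_sym sv.
have := edge3_eq (R3 gR) xg vg sg vg' u3.
by rewrite (negPf vx') eq_sym [v' == s]eq_sym (negPf sv') orbF => /eqP.
Qed.

Lemma one_sided_card : #|one_sided x y| <= #|one_sided y x| /\
  (#|one_sided y x| <= #|one_sided x y| -> forall s, s \in one_sided y x ->
     exists2 v, v \in one_sided x y & link x v s).
Proof.
apply: injective_rel_card => [v /one_sidedP[vB vx vy nz [nxv _]]|v v' s].
  exact: link_exists.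
exact: link_inj.
Qed.

End NoFlip.

(** Links inject each of the two one-sided sets into the other, so the sizes agree and the injection
    is onto. *)
Lemma link_onto x y : x \in B -> y \in B -> x != y -> ~ flip R w x y ->
  forall s, s \in one_sided y x -> exists2 v, v \in one_sided x y & link x v s.
Proof.
move=> xB yB xy nf; have nf' : ~ flip R w y x by move/flipC.
have yx : y != x by rewrite eq_sym.
have [_] := one_sided_card xB xy nf; apply.
by have [] := one_sided_card yB yx nf'.
Qed.

Section Contradiction.
Variables x y : V.
Hypotheses (xB : x \in B) (yB : y \in B) (xy : x != y).
Hypothesis nf : ~ flip R w x y.

(** If [v] slides to neither, it is linked to some [s] that by [link_onto] has a one-sided partner.
    Both links use the same edge, so the partner is [v], yet it slides to [y]. *)
Lemma vertex_cases v : v \in B -> v != x -> v != y ->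
  [|| apex x y v, v \in one_sided x y | v \in one_sided y x].
Proof.
move=> vB vx vy; apply: contraT; rewrite !negb_or => /and3P[nz n1 n2].
have [sx|nsx] := boolP (slidable x v).
  suff : v \in one_sided y x by rewrite (negPf n2).
  apply/one_sidedP; split=> //; first by rewrite apexC.
  by split=> //; apply: contra nz; exact: slidable_both.
have [sy|nsy] := boolP (slidable y v).
  by suff : v \in one_sided x y by [rewrite (negPf n1)]; apply/one_sidedP.
have [s sY /linkP[g [gR xg vg wg]]] := link_exists xB xy nf vB vx vy nz nsx.
have [v' v'X /linkP[g' [g'R xg' vg' wg']]] := link_onto xB yB xy nf sY.
case/one_sidedP: sY => _ sy sx _ [_ sxs].
have sv : s != v by apply: contraNneq nsx => <-.
have sv' : s != v'.
  by case/one_sidedP: v'X => _ _ _ _ [+ _]; apply: contraNneq => <-.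
have sg : s \in vset g by rewrite -wg choice_funP.
have sl : slides w g x s by rewrite /slides xg sg wg eqxx eq_sym sx orbT.
have gg' : g = g' := link_unique xy nf v'X g'R xg' vg' wg' sx sv' gR sl.
subst g'; have u3 : uniq [:: x; v; s].
  by rewrite /= !inE negb_or andbT [x == v]eq_sym vx eq_sym sx eq_sym sv.
have := edge3_eq (R3 gR) xg vg sg vg' u3.
case/one_sidedP: (v'X) => _ v'x _ _ [_ yv'].
rewrite (negPf v'x) eq_sym [v' == s]eq_sym (negPf sv') orbF => /eqP vv'.
by rewrite vv' yv' in nsy.
Qed.

(** For an apex [c] its own apex edge works. A one-sided [c] is, by [link_onto], the choice on an
    edge whose vertex besides [y] and [c] is no apex, hence not [z]. *)
Lemma apex_avoiding z c : apex x y z -> c != z ->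
  apex x y c || (c \in one_sided x y) ->
  exists2 h, h \in R & slides w h c y && (z \notin vset h).
Proof.
move=> az cz; have [ez [ezR [xe ye ze we] [zx zy] _]] := apexP xy nf az.
case/orP=> [ac|cX].
  have [h [hR [xh yh ch wh] [cx cy] [_ sl]]] := apexP xy nf ac.
  exists h => //; rewrite sl; apply/negP => zh.
  have u3 : uniq [:: x; y; c] by rewrite /= !inE negb_or xy eq_sym cx eq_sym cy.
  have := edge3_eq (R3 hR) xh yh ch zh u3.
  by rewrite (negPf zx) (negPf zy) eq_sym (negPf cz).
have nf' : ~ flip R w y x by move/flipC.
have yx : y != x by rewrite eq_sym.
have [u uY /linkP[h [hR yh uh wh]]] := link_onto yB xB yx nf' cX.
case/one_sidedP: cX => _ cx cy nc [nxc _].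
case/one_sidedP: uY => _ uy ux nu [nyu xu].
have uc : u != c by apply: contraNneq nxc => <-.
have ch : c \in vset h by rewrite -wh choice_funP.
exists h => //; rewrite /slides yh ch cy wh eqxx /=; apply/negP => zh.
have u3 : uniq [:: y; u; c] by rewrite /= !inE negb_or [y == u]eq_sym uy eq_sym cy uc.
have := edge3_eq (R3 hR) yh uh ch zh u3.
rewrite (negPf zy) [z == c]eq_sym (negPf cz) orbF => /eqP zu.
by rewrite -zu apexC az in nu.
Qed.

Lemma apex_no_slide z c k : apex x y z -> c != z -> c != x -> c != y ->
  apex x y c || (c \in one_sided x y) -> k \in R -> ~~ slides w k z c.
Proof.
move=> az cz cx cy hc kR; apply/negP => sl.
have [e [eR [xe ye ze we] [zx zy] [s1 _]]] := apexP xy nf az.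
have [h hR /andP[s3 zh]] := apex_avoiding az cz hc.
have [zk ck] : z \in vset k /\ c \in vset k by case/and4P: sl.
apply: (noflip3 nf eR kR hR _ _ _ s1 sl s3).
- apply: contraTneq ck => <-; apply/negP => ce.
  have u3 : uniq [:: x; y; z] by rewrite /= !inE negb_or xy eq_sym zx eq_sym zy.
  have := edge3_eq (R3 eR) xe ye ze ce u3.
  by rewrite (negPf cx) (negPf cy) (negPf cz).
- by apply: contraNneq zh => <-.
- by apply: contraNneq zh => <-.
Qed.

End Contradiction.

(** If no flip exists, an edge [e] on [x], [y] has its apex [z] chosen, and no other edge of [R]
    slides [z]. An edge joining [z] to a vertex off [e] would do so; hence [B] lies in [e]. All
    edges of [R] are then copies of [e] with choice [z], and two copies would chain [x], [z],
    [y]. *)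
Lemma flip_exists x y : (3 < #|B|) || (1 < #|R|) -> x \in B -> y \in B -> x != y ->
  flip R w x y.
Proof.
move=> BR xB yB xy; apply: flip_stable => nf.
have nf' : ~ flip R w y x by move/flipC.
have yx : y != x by rewrite eq_sym.
have [e eR /andP[xe ye]] := Rcov xB yB xy.
have az : apex x y (w e) by apply/exists_inP; exists e; rewrite // xe ye eqxx.
set z := w e in az; have we : w e = z by [].
have ze : z \in vset e by exact: choice_funP.
have [_ [_ _ [zx zy] _]] := apexP xy nf az.
have u3 : uniq [:: x; y; z] by rewrite /= !inE negb_or xy eq_sym zx eq_sym zy.
have zB : z \in B by exact: (subsetP (RB eR)).
have ez c : c \in vset e -> [|| c == x, c == y | c == z].
  by move=> ce; exact: edge3_eq (R3 eR) xe ye ze ce u3.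
have noslide c k : c \in B -> c != z -> k \in R -> slides w k z c -> k = e.
  move=> cB cz kR sl.
  have [cx|cx] := eqVneq c x.
    by apply: (apex_slide xy nf kR eR _ xe ye we); rewrite slidesC -cx.
  have [cy|cy] := eqVneq c y.
    by apply: (apex_slide yx nf' kR eR _ ye xe we); rewrite slidesC -cy.
  have az' : apex y x z by rewrite apexC.
  have n1 := @apex_no_slide x y xB yB xy nf z c k az cz cx cy.
  have n2 := @apex_no_slide y x yB xB yx nf' z c k az' cz cy cx.
  case/or3P: (vertex_cases xB yB xy nf cB cx cy) => hc.
  - by move: n1; rewrite hc => /(_ isT kR); rewrite sl.
  - by move: n1; rewrite hc orbT => /(_ isT kR); rewrite sl.
  - by move: n2; rewrite hc orbT => /(_ isT kR); rewrite sl.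
have Be v : v \in B -> v \in vset e.
  move=> vB; apply: contraT => ve.
  have vz : v != z by apply: contraNneq ve => ->.
  have [|k kR /andP[zk vk]] := Rcov zB vB; first by rewrite eq_sym.
  have wk := choice_funP k cw.
  have ke : k != e by apply: contraNneq ve => <-.
  suff [c [cB cz sl]] : exists c, [/\ c \in B, c != z & slides w k z c].
    by rewrite (noslide c k) ?eqxx in ke.
  have [wz|wz] := eqVneq (w k) z.
    by exists v; split; rewrite // /slides zk vk wz eqxx eq_sym vz.
  exists (w k); split=> //; first exact: (subsetP (RB kR)).
  by rewrite /slides zk wk eq_sym wz eqxx orbT.
case/orP: BR => [B4|/card_gt1P[k1 [k2 [k1R k2R k12]]]].
  have : B \subset vset e by apply/subsetP.
  by move/subset_leq_card; rewrite R3 // leqNgt B4.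
have all k : k \in R -> k = e.
  move=> kR; have /eqP vk : vset k == vset e.
    rewrite eqEcard !R3 // leqnn andbT.
    by apply/subsetP => v /(subsetP (RB kR))/Be.
  apply: (apex_slide xy nf kR eR _ xe ye we).
  have := noflip1 nf kR; have wk := choice_funP k cw.
  rewrite /slides vk xe ye ze xy [x == z]eq_sym zx negb_or => /andP[wx wy].
  by rewrite vk in wk; have := ez _ wk; rewrite (negPf wx) (negPf wy) /= => ->.
by rewrite (all k1) // (all k2) // eqxx in k12.
Qed.

End Flip.

(** * Even choices and the trails they carry *)

Section EvenChoices.
Variable H : hypergraph.
Local Notation V := (vertex H).
Local Notation E := (edge H).
Implicit Types (w : {ffun E -> V}) (R : {set E}).

Lemma anchored_pair w e p : choice_fun w -> #|vset e| = 3 -> anchored w e p ->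
  exists c, [/\ c \in vset e, c != p &
    forall v, anchored w e v = (v == p) (+) (v == c)].
Proof.
move=> cw e3 /andP[pe pw]; have we := choice_funP e cw.
have [|c [ce cw' cp h]] := third_vertex e3 we pe; first by rewrite eq_sym.
exists c; split=> // v; rewrite /anchored; have [ve|ve] /= := boolP (v \in vset e).
  case: (h v ve) => ->; rewrite ?eqxx.
  - by rewrite eq_sym (negPf pw) eq_sym (negPf cw').
  - by rewrite pw eq_sym (negPf cp).
  - by rewrite cw' (negPf cp).
have -> : (v == p) = false by apply: contraNF ve => /eqP->.
by have -> : (v == c) = false by apply: contraNF ve => /eqP->.
Qed.

Lemma parity_true R w v : parity R w v -> exists2 e, e \in R & anchored w e v.
Proof.
move=> odd; have [/exists_inP[e eR h]|] := boolP [exists e in R, anchored w e v].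
  by exists e.
rewrite negb_exists_in => /forall_inP h; move: odd; rewrite /parity big1 // => e /h.
by move/negPf.
Qed.

Lemma addb_sum_parity R w : choice_fun w -> (forall e, e \in R -> #|vset e| = 3) ->
  \big[addb/false]_v parity R w v = false.
Proof.
move=> cw R3; rewrite exchange_big /= big1 // => e eR.
have we := choice_funP e cw.
have -> : \big[addb/false]_v anchored w e v = odd (\sum_v anchored w e v).
  rewrite (big_morph odd oddD (erefl : odd 0 = false)).
  by apply: eq_bigr => v _; rewrite oddb.
have -> : \sum_v anchored w e v = #|vset e :\ w e|.
  rewrite -sum1_card [RHS]big_mkcond /=; apply: eq_bigr => v _.
  by rewrite /anchored !inE andbC; case: ifP.
by have := cardsD1 (w e) (vset e); rewrite we R3 // add1n => -[<-].
Qed.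

(** Minimize the number of odd vertices. By the handshake lemma [addb_sum_parity] an odd vertex has
    an odd companion, and flipping both lowers the number. *)
Lemma even_choice R : (forall e : E, #|vset e| = 3) -> (forall w x y,
    choice_fun w -> x != y -> flip R w x y) ->
  exists2 w, choice_fun w & forall v, parity R w v = false.
Proof.
move=> E3 fl.
have [w0 cw0] : exists w, choice_fun w.
  have ne (e : E) : exists v, v \in vset e by apply/card_gt0P; rewrite E3.
  exists [ffun e => xchoose (ne e)]; apply/forallP => e; rewrite ffunE.
  exact: (xchooseP (ne e)).
pose odds w := [set v | parity R w v].
case: (arg_minnP (fun w => #|odds w|) cw0) => w cw wmin.
exists w => // x; apply/negP => px.
have [/existsP[y /andP[yx py]]|] := boolP [exists y, (y != x) && parity R w y].
  have xy : x != y by rewrite eq_sym.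
  have [w' cw' pw'] := fl w x y cw xy.
  have := wmin w' cw'; apply/negP; rewrite -ltnNge; apply: proper_card.
  rewrite properE; apply/andP; split.
    apply/subsetP => v; rewrite !inE pw'.
    have [->|vx] := eqVneq v x; first by rewrite px.
    by have [->|vy] := eqVneq v y; rewrite ?py // !addbF.
  apply/subsetPn; exists x; first by rewrite inE.
  by rewrite inE pw' px eqxx (negPf xy).
rewrite negb_exists => /forallP h.
have := addb_sum_parity cw (fun e (_ : e \in R) => E3 e).
rewrite (bigD1 x) //= px big1 // => v vx.
by have := h v; rewrite vx => /negPf.
Qed.

(** Leave [p] by an edge anchored there. Deleting it shifts the odd vertex from [p] to the other
    anchor; continue until [q] is reached. *)
Lemma parity_trail R w p q : choice_fun w -> (forall e, e \in R -> #|vset e| = 3) ->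
  (forall v, parity R w v = (v == p) (+) (v == q)) ->
  exists es, [/\ joins p es q, uniq es, {subset es <= R} &
    forall v, parity (R :\: [set e in es]) w v = false].
Proof.
move=> cw; have [n] := ubnP #|R|; elim: n => // n IH in R p *.
rewrite ltnS => Rn R3 par; have [pq|pq] := eqVneq p q.
  exists [::]; split=> // [|v]; first by rewrite pq; exact: joins0.
  have -> : R :\: [set e in [::]] = R by apply/setP => e; rewrite !inE.
  by rewrite par pq addbb.
have /parity_true[e eR ae] : parity R w p by rewrite par eqxx (negPf pq).
have [c [ce cp hc]] := anchored_pair cw (R3 e eR) ae.
have [|e' /setD1P[_ e'R]|v|es [j u sub ev]] := IH (R :\ e) c.
- by move: Rn; rewrite (cardsD1 e R) eR.
- exact: R3.
- have := par v; rewrite (parityD1 w v eR) hc.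
  by case: (v == p); case: (v == c); case: (v == q); case: (parity _ _ _).
exists (e :: es); split.
- by apply: joins_cons j => //; [case/andP: ae | rewrite eq_sym].
- by rewrite /= u andbT; apply/negP => /sub; rewrite setD11.
- by move=> e'; rewrite inE => /predU1P[->//|/sub/setD1P[]].
- move=> v; rewrite -(ev v); congr (parity _ w v).
  by apply/setP => e'; rewrite !inE negb_or; case: (e' == e); rewrite /= ?andbF.
Qed.

Lemma even_trail R w e p : choice_fun w -> (forall e, e \in R -> #|vset e| = 3) ->
  (forall v, parity R w v = false) -> e \in R -> anchored w e p ->
  exists es, [/\ joins p es p, uniq es, {subset es <= R}, es != [::] &
    forall v, parity (R :\: [set e in es]) w v = false].
Proof.
move=> cw R3 par eR ae; have [c [ce cp hc]] := anchored_pair cw (R3 e eR) ae.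
have [|v|es [j u sub ev]] := @parity_trail (R :\ e) w c p cw.
- by move=> e' /setD1P[_]; exact: R3.
- have := par v; rewrite (parityD1 w v eR) hc.
  by case: (v == p); case: (v == c); case: (parity _ _ _).
exists (e :: es); split=> //.
- by apply: joins_cons j => //; [case/andP: ae | rewrite eq_sym].
- by rewrite /= u andbT; apply/negP => /sub; rewrite setD11.
- by move=> e'; rewrite inE => /predU1P[->//|/sub/setD1P[]].
- move=> v; rewrite -(ev v); congr (parity _ w v).
  by apply/setP => e'; rewrite !inE negb_or; case: (e' == e); rewrite /= ?andbF.
Qed.

End EvenChoices.

(** * Maximal closed trails with an even complement *)

Section Triples.
Variable H : hypergraph.
Local Notation V := (vertex H).
Local Notation E := (edge H).
Hypothesis E3 : forall e : E, #|vset e| = 3.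
Hypothesis pair_cover : forall a b : V, a != b ->
  exists e : E, (a \in vset e) && (b \in vset e).
Variables (T : seq (dart H)) (w : {ffun E -> V}).
Local Notation F := (dart_edges T).
Local Notation R := (~: [set e in F]).
Hypothesis cT : closed_trail T.
Hypothesis cw : choice_fun w.
Hypothesis evenR : forall v, parity R w v = false.
Hypothesis Tmax : forall (x : V) es (w' : {ffun E -> V}), joins x es x -> uniq es -> choice_fun w' ->
  (forall v, parity (~: [set e in es]) w' v = false) -> size es <= size T.
Hypothesis R0 : R != set0.

Lemma uniqF : uniq F.
Proof. by case/andP: cT. Qed.

Lemma mem_rest e : (e \in R) = (e \notin F).
Proof. by rewrite !inE. Qed.

Lemma no_growth x es es' w' : joins x es x -> perm_eq es (es' ++ F) ->
  uniq es' -> {subset es' <= R} -> es' != [::] -> choice_fun w' ->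
  (forall v, parity (R :\: [set e in es']) w' v = false) -> False.
Proof.
move=> j p u sub n0 cw' ev.
have u' : uniq es.
  rewrite (perm_uniq p) cat_uniq u uniqF andbT /=.
  apply/hasPn => e eF; apply/negP => /sub.
  by rewrite mem_rest eF.
have : size es <= size T.
  apply: (Tmax j u' cw') => v; rewrite -(ev v); congr (parity _ w' v).
  by apply/setP => e; rewrite !inE (perm_mem p) mem_cat negb_or.
rewrite (perm_size p) size_cat size_map -[X in _ <= X]add0n leq_add2r leqn0.
by rewrite size_eq0 (negPf n0).
Qed.

(** After a flip, [R] is odd at [p] and [q] only, so it contains a trail from [p] to [q] with even
    remainder, which [es] closes up to a longer trail. *)
Lemma noflip p q es : p != q -> joins q es p -> perm_eq es F -> ~ flip R w p q.
Proof.
move=> pq j pm [w' cw' par].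
have [|es' [j' u sub ev]] := @parity_trail _ R w' p q cw' (fun e _ => E3 e).
  by move=> v; rewrite par evenR.
apply: (no_growth (joins_cat j' j) _ u sub _ cw' ev); first by rewrite perm_cat2l.
case: es' j' {u sub ev} => // -[T' + eT']; case: T' eT' => //= _ /eqP E.
by rewrite E eqxx in pq.
Qed.

(** * Reroutings of the trail that forbid flips *)

Definition touched := [set v | has (fun d => (v == d.1.1) || (v == d.2)) T].
Local Notation A := touched.

Lemma touched_src x f y : (x, f, y) \in T -> x \in A.
Proof. by move=> d; rewrite inE; apply/hasP; exists (x, f, y); rewrite //= eqxx. Qed.

Lemma touched_tgt x f y : (x, f, y) \in T -> y \in A.
Proof.
by move=> d; rewrite inE; apply/hasP; exists (x, f, y); rewrite //= eqxx orbT.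
Qed.

Lemma touched_joins v : v \in A -> exists2 es, joins v es v & perm_eq es F.
Proof.
rewrite inE => /hasP[[[x f] y] d /=]; have [xf yf xy [es j p]] := closed_trail_dart cT d.
case/orP=> /eqP->.
  by exists (f :: es) => //; apply: joins_cons j.
exists (es ++ [:: f]); last by perm_count.
by apply: joins_cat j _; apply: joins1.
Qed.

(** A closed trail of the rest through a touched anchor could be spliced into [T] there. *)
Lemma rest_anchor_untouched w' e v : choice_fun w' ->
  (forall v, parity R w' v = false) -> e \in R -> anchored w' e v -> v \notin A.
Proof.
move=> cw' par eR ae; apply/negP => /touched_joins[es j p].
have [es' [j' u sub n0 ev]] := even_trail cw' (fun e _ => E3 e) par eR ae.
by apply: (no_growth (joins_cat j' j) _ u sub n0 cw' ev); rewrite perm_cat2l.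
Qed.

Lemma rest_touched e v : e \in R -> v \in vset e -> v \in A -> w e = v.
Proof.
move=> eR ve; apply: contraTeq => we.
by apply: rest_anchor_untouched cw evenR eR _; rewrite /anchored ve eq_sym.
Qed.

Definition spare x f y p := [&& (x, f, y) \in T, p \in vset f, p != x & p != y].

Lemma spareP x f y p : spare x f y p ->
  [/\ (x, f, y) \in T, [/\ x \in vset f, y \in vset f & x != y],
      [/\ p \in vset f, p != x & p != y] &
      forall v, v \in vset f -> [\/ v = x, v = y | v = p]].
Proof.
case/and4P=> d pf px py; have [xf yf xy _] := closed_trail_dart cT d; split=> // v vf.
have u3 : uniq [:: x; y; p] by rewrite /= !inE negb_or xy eq_sym px eq_sym py.
by case/or3P: (edge3_eq (E3 f) xf yf pf vf u3) => /eqP->; constructor.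
Qed.

Lemma spare_exists f : f \in F -> exists x y p, spare x f y p.
Proof.
case/dart_edgesP=> x [y d]; have [xf yf xy _] := closed_trail_dart cT d.
have [p [pf px py _]] := third_vertex (E3 f) xf yf xy.
by exists x, y, p; rewrite /spare d pf px.
Qed.

Lemma spare_unique x f y p x' y' p' : spare x f y p -> spare x' f y' p' -> p = p'.
Proof.
move=> /spareP[d _ [pf px py] _] /spareP[d' _ _ h].
have : (x, f, y) = (x', f, y').
  move: uniqF d d'; rewrite /dart_edges.
  elim: (T) => //= e T' IH /andP[nin u]; rewrite !inE.
  case/predU1P=> [E1|d1] /predU1P[E2|d2]; last exact: IH.
  - by rewrite E1 E2.
  - by case/negP: nin; apply/mapP; exists (x', f, y'); rewrite // -E1.
  - by case/negP: nin; apply/mapP; exists (x, f, y); rewrite // -E2.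
by case=> ex ey; case: (h p pf) => // E; rewrite E ?ex ?ey eqxx in px py.
Qed.

(** Traversing [f] from [p] instead of [x], or to [p] instead of [y], opens [T] into a trail between
    the two vertices. *)
Lemma spare_noflip x f y p : spare x f y p -> ~ flip R w p x /\ ~ flip R w p y.
Proof.
case/spareP=> d [xf yf xy] [pf px py] _; have [_ _ _ [es j pm]] := closed_trail_dart cT d.
split.
  move/flipC; apply: (@noflip _ _ (f :: es)) => //; first by rewrite eq_sym.
  exact: joins_cons j.
apply: (@noflip _ _ (es ++ [:: f])) => //; last by perm_count.
by apply: joins_cat j _; apply: joins1; rewrite // eq_sym.
Qed.

Definition enters v f p := exists x, spare x f v p.
Definition leaves v f p := exists x, spare v f x p.
Definition visits v f p := enters v f p \/ leaves v f p.

(** The tour [a f v P b g v Q a] is rerouted as [p f a Q^-1 v P b g q]. *)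
Lemma same_enter_noflip v f g p q : p != q -> enters v f p -> enters v g q ->
  ~ flip R w p q.
Proof.
move=> pq [a s1] [b s2].
have fg : f != g by apply: contra pq => /eqP E; subst g; rewrite (spare_unique s1 s2).
have [d1 [af vf av] [pf pa pv] _] := spareP s1.
have [d2 [bg vg bv] [qg qb qv] _] := spareP s2.
have [es1 [es2 [j1 j2 pm]]] := closed_trail_darts2 cT d1 d2 fg.
move/flipC; apply: (@noflip _ _ (f :: rev es2 ++ es1 ++ [:: g])); first by rewrite eq_sym.
  apply: (joins_cons pf af pa); apply: joins_cat (joins_rev j2) _.
  by apply: joins_cat j1 _; apply: joins1; rewrite // eq_sym.
by perm_count.
Qed.

Lemma same_leave_noflip v f g p q : p != q -> leaves v f p -> leaves v g q ->
  ~ flip R w p q.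
Proof.
move=> pq [a s1] [b s2].
have fg : f != g by apply: contra pq => /eqP E; subst g; rewrite (spare_unique s1 s2).
have [d1 [vf af av] [pf pv pa] _] := spareP s1.
have [d2 [vg bg bv] [qg qv qb] _] := spareP s2.
have [es1 [es2 [j1 j2 pm]]] := closed_trail_darts2 cT d1 d2 fg.
move/flipC; apply: (@noflip _ _ (f :: es1 ++ rev es2 ++ [:: g])); first by rewrite eq_sym.
  apply: (joins_cons pf af pa); apply: joins_cat j1 _.
  by apply: joins_cat (joins_rev j2) _; apply: joins1; rewrite // eq_sym.
by perm_count.
Qed.

Lemma visits3_noflip v f1 f2 f3 p1 p2 p3 : p1 != p2 -> p1 != p3 -> p2 != p3 ->
  visits v f1 p1 -> visits v f2 p2 -> visits v f3 p3 ->
  flip R w p1 p2 -> flip R w p1 p3 -> flip R w p2 p3 -> False.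
Proof.
move=> n12 n13 n23 v1 v2 v3 h12 h13 h23.
have E := same_enter_noflip; have L := same_leave_noflip.
case: v1 v2 v3 => [v1|v1] [v2|v2] [v3|v3].
- exact: E n12 v1 v2 h12.
- exact: E n12 v1 v2 h12.
- exact: E n13 v1 v3 h13.
- exact: L n23 v2 v3 h23.
- exact: E n23 v2 v3 h23.
- exact: L n13 v1 v3 h13.
- exact: L n12 v1 v2 h12.
- exact: L n12 v1 v2 h12.
Qed.

(** The tour [z g p P x f y Q z] is rerouted as [p P x g z Q^-1 y f q]. *)
Lemma spare_leave_noflip z g p x f q : p != q -> spare z g p x -> leaves x f q ->
  ~ flip R w p q.
Proof.
move=> pq s1 [y s2].
have [d1 [zg pg zp] [xg xz xp] _] := spareP s1.
have [d2 [xf yf xy] [qf qx qy] _] := spareP s2.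
have gf : g != f.
  apply: contra qx => /eqP E; subst g; by rewrite (spare_unique s1 s2).
have [es1 [es2 [j1 j2 pm]]] := closed_trail_darts2 cT d1 d2 gf.
move/flipC; apply: (@noflip _ _ (es1 ++ g :: rev es2 ++ [:: f])); first by rewrite eq_sym.
  apply: joins_cat j1 _; apply: (joins_cons xg zg xz).
  by apply: joins_cat (joins_rev j2) _; apply: joins1; rewrite // eq_sym.
by perm_count.
Qed.

Lemma spare_enter_noflip z g p x f q : p != q -> spare p g z x -> enters x f q ->
  ~ flip R w p q.
Proof.
move=> pq s1 [y s2].
have [d1 [pg zg pz] [xg xp xz] _] := spareP s1.
have [d2 [yf xf yx] [qf qy qx] _] := spareP s2.
have gf : g != f.
  apply: contra qx => /eqP E; subst g; by rewrite (spare_unique s1 s2).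
have [es1 [es2 [j1 j2 pm]]] := closed_trail_darts2 cT d1 d2 gf.
move/flipC; apply: (@noflip _ _ (rev es2 ++ g :: es1 ++ [:: f])); first by rewrite eq_sym.
  apply: joins_cat (joins_rev j2) _; apply: (joins_cons xg zg xz).
  by apply: joins_cat j1 _; apply: joins1; rewrite // eq_sym.
by perm_count.
Qed.

Lemma untouched_spare f b : f \in F -> b \in vset f -> b \notin A ->
  exists x y, spare x f y b.
Proof.
move=> /spare_exists[x [y [p s]]] bf bA; exists x, y.
have [d _ _ h] := spareP s.
by case: (h b bf) => E //; rewrite E ?(touched_src d) ?(touched_tgt d) // in bA *.
Qed.

Lemma spare_visits x f y p a : spare x f y p -> a \in vset f -> a != p -> visits a f p.
Proof.
move=> s af ap; have [_ _ _ h] := spareP s.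
case: (h a af) => E; first by right; exists y; rewrite E.
  by left; exists x; rewrite E.
by rewrite E eqxx in ap.
Qed.

Lemma untouched_visits f a b : f \in F -> a \in vset f -> b \in vset f ->
  b \notin A -> a != b -> visits a f b.
Proof.
by move=> fF af bf bA; have [x [y s]] := untouched_spare fF bf bA; exact: spare_visits s af.
Qed.

(** An edge of [T] can have only its spare vertex untouched. *)
Lemma untouched_pair b b' : b != b' -> b \notin A -> b' \notin A ->
  exists2 e, e \in R & (b \in vset e) && (b' \in vset e).
Proof.
move=> bb' bA b'A; have [e /andP[be b'e]] := pair_cover bb'.
exists e; last by rewrite be.
rewrite mem_rest; apply/negP => eF.
have [x [y s]] := untouched_spare eF be bA.
have [x' [y' s']] := untouched_spare eF b'e b'A.
by rewrite (spare_unique s s') eqxx in bb'.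
Qed.

Lemma touched_pair a a' : a != a' -> a \in A -> a' \in A ->
  exists2 f, f \in F & (a \in vset f) && (a' \in vset f).
Proof.
move=> aa' aA a'A; have [e /andP[ae a'e]] := pair_cover aa'.
exists e; last by rewrite ae.
apply: contraT; rewrite -mem_rest => eR.
by rewrite -(rest_touched eR ae aA) -(rest_touched eR a'e a'A) eqxx in aa'.
Qed.

(** * Near and far vertices *)

Definition near a b := [exists e in R, (a \in vset e) && (b \in vset e)].

Lemma nearI e a b : e \in R -> a \in vset e -> b \in vset e -> near a b.
Proof. by move=> eR ae be; apply/exists_inP; exists e; rewrite // ae. Qed.

Lemma nearP a b : a \in A -> b \notin A -> near a b ->
  exists e, [/\ e \in R, a \in vset e, b \in vset e, w e = a & slides w e a b].
Proof.
move=> aA bA /exists_inP[e eR /andP[ae be]]; have we := rest_touched eR ae aA.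
exists e; split=> //; rewrite /slides ae be we eqxx andbT.
by apply: contraNneq bA => <-.
Qed.

Lemma far_visits a b : a \in A -> b \notin A -> ~~ near a b -> exists f, visits a f b.
Proof.
move=> aA bA nab; have ab : a != b by apply: contraNneq bA => <-.
have [e /andP[ae be]] := pair_cover ab; exists e; apply: untouched_visits => //.
by apply: contraT; rewrite -mem_rest => eR; rewrite (nearI eR ae be) in nab.
Qed.

Lemma visits_noflip a f b : visits a f b -> ~ flip R w a b.
Proof.
case=> -[x s] /flipC fl; have [n1 n2] := spare_noflip s; by [apply: n1|apply: n2].
Qed.

Lemma near_flip a b : a \in A -> b \notin A -> near a b -> flip R w a b.
Proof. by move=> aA bA /(nearP aA bA)[e [eR _ _ _ sl]]; apply: flip1 sl. Qed.

Lemma near_flip2 a a' b : a \in A -> a' \in A -> a != a' -> b \notin A ->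
  near a b -> near a' b -> flip R w a a'.
Proof.
move=> aA a'A aa' bA /(nearP aA bA)[e [eR _ _ we sl]] /(nearP a'A bA).
case=> e' [e'R _ _ we' sl']; rewrite slidesC in sl'.
by apply: flip2 sl sl' => //; apply: contra aa' => /eqP E; rewrite -we -we' E.
Qed.

Lemma rest_mate e a b : e \in R -> a \in A -> a \in vset e -> b \in vset e ->
  b \notin A -> exists d, [/\ d \in vset e, d \notin A, d != b, d != a &
    forall v, v \in vset e -> [\/ v = a, v = b | v = d]].
Proof.
move=> eR aA ae be bA; have ab : a != b by apply: contraNneq bA => <-.
have [d [de da db h]] := third_vertex (E3 e) ae be ab; exists d; split=> //.
by apply: contra da => dA; rewrite -(rest_touched eR de dA) (rest_touched eR ae aA).
Qed.

Lemma anchored2 e p q : p \in vset e -> q \in vset e -> p != q -> w e != p -> w e != q ->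
  forall v, anchored w e v = (v == p) (+) (v == q).
Proof.
move=> pe qe pq wp wq; have ap : anchored w e p by rewrite /anchored pe eq_sym.
have [c [ce cp h]] := anchored_pair cw (E3 e) ap.
have := h q; rewrite /anchored qe eq_sym wq /= [q == p]eq_sym (negPf pq) /=.
by move/esym/eqP=> ->.
Qed.

(* The tour [a1 f1 c1 P a2 f2 c2 Q a1] becomes                                  *)
(* [y2 r3 y1 f1 c1 P a2 r2 y3 r1 a1 Q^-1 c2 f2 y2]; the choice stays even since *)
(* the anchors of [r1], [r2], [r3] form the triangle [y1 y2 y3].                *)
Lemma no_triangle a1 a2 y1 y2 y3 f1 f2 r1 r2 r3 :
  (leaves a1 f1 y1 /\ leaves a2 f2 y2) \/ (enters a1 f1 y1 /\ enters a2 f2 y2) ->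
  uniq [:: y1; y2; y3] -> r1 \in R -> r2 \in R -> r3 \in R -> w r1 = a1 -> w r2 = a2 ->
  (forall v, anchored w r1 v = (v == y2) (+) (v == y3)) ->
  (forall v, anchored w r2 v = (v == y1) (+) (v == y3)) ->
  (forall v, anchored w r3 v = (v == y1) (+) (v == y2)) -> False.
Proof.
move=> lv uy r1R r2R r3R w1 w2 h1 h2 h3.
move: uy; rewrite /= !inE negb_or andbT => /andP[/andP[y12 y13] y23].
have a1r := choice_funP r1 cw; have a2r := choice_funP r2 cw; rewrite w1 in a1r; rewrite w2 in a2r.
have /andP[y3r1 y3a1] : anchored w r1 y3 by rewrite h1 eqxx eq_sym (negPf y23).
have /andP[y3r2 y3a2] : anchored w r2 y3 by rewrite h2 eqxx eq_sym (negPf y13).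
have /andP[y1r3 _] : anchored w r3 y1 by rewrite h3 eqxx (negPf y12).
have /andP[y2r3 _] : anchored w r3 y2 by rewrite h3 eqxx eq_sym (negPf y12).
rewrite w1 in y3a1; rewrite w2 in y3a2.
have r12 : r1 != r2.
  by apply/eqP => E; have := h1 y1; rewrite E h2 eqxx (negPf y12) (negPf y13).
have r13 : r1 != r3.
  by apply/eqP => E; have := h1 y1; rewrite E h3 eqxx (negPf y12) (negPf y13).
have r23 : r2 != r3.
  by apply/eqP => E; have := h2 y2; rewrite E h3 eqxx eq_sym (negPf y12) (negPf y23).
have fin x es : joins x es x -> perm_eq es ([:: r1; r2; r3] ++ F) -> False.
  move=> j p; apply: (no_growth j p _ _ _ cw) => //.
  - by rewrite /= !inE negb_or r12 r13 r23.
  - by move=> r; rewrite !in_cons in_nil orbF => /or3P[] /eqP->.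
  - move=> v; have := evenR v; rewrite (parityD1 w v r1R).
    rewrite (@parityD1 _ (R :\ r1) w r2); last by rewrite in_setD1 eq_sym r12.
    rewrite (@parityD1 _ (R :\ r1 :\ r2) w r3); last first.
      by rewrite !in_setD1 eq_sym r23 eq_sym r13.
    rewrite h1 h2 h3 (_ : R :\ r1 :\ r2 :\ r3 = R :\: [set e in [:: r1; r2; r3]]).
      by case: (parity _ w v); case: (v == y1); case: (v == y2); case: (v == y3).
    apply/setP => e; rewrite !inE !negb_or.
    by case: (e == r1); case: (e == r2); case: (e == r3).
have y21 : y2 != y1 by rewrite eq_sym.
case: lv => -[[c1 s1] [c2 s2]].
- have f12 : f1 != f2.
    by apply: contra y12 => /eqP E; subst f2; rewrite (spare_unique s1 s2).
  have [d1 [a1f c1f _] [y1f _ y1c] _] := spareP s1.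
  have [d2 [a2f c2f _] [y2f _ y2c] _] := spareP s2.
  have [es1 [es2 [j1 j2 pm]]] := closed_trail_darts2 cT d1 d2 f12.
  apply: fin.
    apply: (joins_cons y2r3 y1r3 y21); apply: (joins_cons y1f c1f y1c).
    apply: joins_cat j1 _; apply: (joins_cons a2r y3r2); first by rewrite eq_sym.
    apply: (joins_cons y3r1 a1r y3a1); apply: joins_cat (joins_rev j2) _.
    by apply: (joins1 c2f y2f); rewrite eq_sym.
  by perm_count.
- have f12 : f1 != f2.
    by apply: contra y12 => /eqP E; subst f2; rewrite (spare_unique s1 s2).
  have [d1 [c1f a1f _] [y1f y1c _] _] := spareP s1.
  have [d2 [c2f a2f _] [y2f y2c _] _] := spareP s2.
  have [es1 [es2 [j1 j2 pm]]] := closed_trail_darts2 cT d1 d2 f12.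
  apply: fin.
    apply: (joins_cons y2r3 y1r3 y21); apply: (joins_cons y1f c1f y1c).
    apply: joins_cat (joins_rev j2) _; apply: (joins_cons a2r y3r2); first by rewrite eq_sym.
    apply: (joins_cons y3r1 a1r y3a1); apply: joins_cat j1 _.
    by apply: (joins1 c2f y2f); rewrite eq_sym.
  by perm_count.
Qed.

(** Were the choice on [r] untouched, [r] would slide an untouched vertex near [a] to one far from
    [a]; chained with an edge at [a], this would flip [a] with a far vertex. *)
Lemma near_far_edge a c c' r : a \in A -> c \notin A -> c' \notin A -> near a c ->
  ~~ near a c' -> r \in R -> c \in vset r -> c' \in vset r ->
  [/\ w r \in A, w r != a & [/\ w r != c, w r != c' & c != c']].
Proof.
move=> aA cA c'A nc nc' rR cr c'r.
have nf b : b \notin A -> ~~ near a b -> ~ flip R w a b.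
  by move=> bA nb; have [f vf] := far_visits aA bA nb; exact: visits_noflip vf.
have cc' : c != c' by apply: contraNneq nc' => <-.
have ar : a \notin vset r by apply: contra nc' => ar; exact: nearI rR ar c'r.
have wr := choice_funP r cw.
suff wA : w r \in A.
  split=> //; first by apply: contraNneq ar => <-.
  by split=> //; apply: contraTneq wA => ->.
apply: contraT => wA.
have via b b' : b \notin A -> b' \notin A -> near a b -> ~~ near a b' ->
    slides w r b b' -> False.
  move=> bA b'A nb nb' sl; have [e [eR ae be we s]] := nearP aA bA nb.
  apply: (nf b' b'A nb'); apply: flip2 s sl => //.
  by apply: contraNneq ar => <-.
have [wc|wc] := eqVneq (w r) c.
  by case: (via c c') => //; rewrite /slides cr c'r cc' wc eqxx.
have [wc'|wc'] := eqVneq (w r) c'.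
  by case: (via c c') => //; rewrite /slides cr c'r cc' wc' eqxx orbT.
have [nw|nw] := boolP (near a (w r)).
  by case: (via (w r) c') => //; rewrite /slides wr c'r wc' eqxx.
by case: (via c (w r)) => //; rewrite /slides cr wr eq_sym wc eqxx orbT.
Qed.

(** If [b'] is far, the edge [ra] on [a], [b], [d] and edges [rv] on [b], [b'] and [ru] on [d], [b']
    have touched choices and anchors forming a triangle. Each choice is far from the opposite
    corner, so [T] visits it with that corner as spare. Two of these visits have the same direction,
    against [no_triangle]. *)
Lemma near_all_or_none a b b' : a \in A -> b \notin A -> b' \notin A ->
  near a b -> near a b'.
Proof.
move=> aA bA b'A nb; apply: contraT => nb'.
have [ra [raR ara bra wra _]] := nearP aA bA nb.
have [d [dra dA db da _]] := rest_mate raR aA ara bra bA.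
have nd : near a d by exact: nearI raR ara dra.
have bb' : b != b' by apply: contraNneq nb' => <-.
have db' : d != b' by apply: contraNneq nb' => <-.
have nAn u z : u \in A -> z \notin A -> u != z by move=> uA; apply: contraNneq => <-.
have [rv rvR /andP[brv b'rv]] := untouched_pair bb' bA b'A.
have [ru ruR /andP[dru b'ru]] := untouched_pair db' dA b'A.
have [vA va [vb vb' _]] := near_far_edge aA bA b'A nb nb' rvR brv b'rv.
have [uA ua [ud ub' _]] := near_far_edge aA dA b'A nd nb' ruR dru b'ru.
have [fa vfa] := far_visits aA b'A nb'.
have nf : ~ flip R w a b' := visits_noflip vfa.
have bd : b != d by rewrite eq_sym.
have four r c c' c'' : c != c' -> c != c'' -> c' != c'' -> w r != c -> w r != c' ->
    w r != c'' -> c \in vset r -> c' \in vset r -> c'' \notin vset r.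
  move=> h1 h2 h3 n1 n2 n3 cr c'r; apply/negP => c''r.
  have u3 : uniq [:: c; c'; c''] by rewrite /= !inE negb_or h1 h2 h3.
  have := edge3_eq (E3 r) cr c'r c''r (choice_funP r cw) u3.
  by rewrite (negPf n1) (negPf n2) (negPf n3).
have drv : d \notin vset rv 
  by apply: (four rv b b' d bb' bd _ vb vb' (nAn _ _ vA dA) brv b'rv); rewrite eq_sym.
have bru : b \notin vset ru 
  by apply: (four ru d b' b db' db _ ud ub' (nAn _ _ uA bA) dru b'ru); rewrite eq_sym.
have sl r c : c \in vset r -> w r != c -> slides w r c (w r).
  by move=> cr wc; rewrite /slides cr (choice_funP r cw) eq_sym wc eqxx orbT.
have sla c : c \in vset ra -> c != a -> slides w ra a c.
  by move=> cr ca; rewrite /slides ara cr wra eqxx eq_sym ca.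
have nwr r r' : w r != w r' -> r != r' by apply: contra => /eqP->.
have rav : ra != rv by apply: nwr; rewrite wra eq_sym.
have rau : ra != ru by apply: nwr; rewrite wra eq_sym.
have rvu : rv != ru by apply: contraNneq drv => ->.
have vu : w rv != w ru.
  apply/eqP => vu; apply: nf.
  apply: (flip3 cw raR rvR ruR rav rau rvu (sla b bra _) (sl rv b brv vb)).
    by rewrite eq_sym nAn.
  by rewrite vu slidesC; apply: sl.
(* Otherwise [a], [c], [w r], [b'] is a chain that flips [a] and [b']. *)
have far r c c' : r \in R -> c \notin A -> c' \notin A -> c \in vset ra ->
    c' \in vset ra -> c' \in vset r -> c \notin vset r -> b' \in vset r ->
    w r \in A -> w r != a -> w r != b' -> ~~ near (w r) c.
  move=> rR cA c'A cra c'ra c'r cr b'r wA wa wb'; apply/negP => nc.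
  have [e [eR ae ce we s]] := nearP wA cA nc.
  apply: nf; apply: (flip3 cw raR eR rR _ _ _ (sla c cra _)).
  - by apply: nwr; rewrite wra we eq_sym.
  - by apply: nwr; rewrite wra eq_sym.
  - by apply: contraNneq cr => <-.
  - by rewrite eq_sym nAn.
  - by rewrite slidesC; exact: s.
  - by rewrite slidesC; exact: sl.
have [fv vfv] := far_visits vA dA (far rv d b rvR dA bA dra bra brv drv b'rv vA va vb').
have [fu vfu] := far_visits uA bA (far ru b d ruR bA dA bra dra dru bru b'ru uA ua ub').
have wb : w ra != b by rewrite wra nAn.
have wd : w ra != d by rewrite wra nAn.
have ha := anchored2 bra dra bd wb wd.
have hv := anchored2 brv b'rv bb' vb vb'.
have hu := anchored2 dru b'ru db' ud ub'.
have ad1 p q v : (v == p) (+) (v == q) = (v == q) (+) (v == p) by rewrite addbC.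
have tri_av : ((leaves a fa b' /\ leaves (w rv) fv d) \/
    (enters a fa b' /\ enters (w rv) fv d)) -> False.
  move=> lv; apply: (no_triangle (y3 := b) lv _ raR rvR ruR wra erefl) => [|v|v|v].
  - by rewrite /= !inE negb_or eq_sym db' eq_sym bb' db.
  - by rewrite ha ad1.
  - by rewrite hv ad1.
  - by rewrite hu ad1.
have tri_au : ((leaves a fa b' /\ leaves (w ru) fu b) \/
    (enters a fa b' /\ enters (w ru) fu b)) -> False.
  move=> lv; apply: (no_triangle (y3 := d) lv _ raR ruR rvR wra erefl) => [|v|v|v].
  - by rewrite /= !inE negb_or eq_sym bb' eq_sym db' bd.
  - by rewrite ha.
  - by rewrite hu ad1.
  - by rewrite hv ad1.
have tri_vu : ((leaves (w rv) fv d /\ leaves (w ru) fu b) \/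
    (enters (w rv) fv d /\ enters (w ru) fu b)) -> False.
  move=> lv; apply: (no_triangle (y3 := b') lv _ rvR ruR raR erefl erefl) => [|v|v|v] //.
  - by rewrite /= !inE negb_or db db' bb'.
  - by rewrite ha ad1.
case: vfa vfv vfu => [l1|l1] [l2|l2] [l3|l3]; exfalso.
- by apply: tri_av; right.
- by apply: tri_av; right.
- by apply: tri_au; right.
- by apply: tri_vu; left.
- by apply: tri_vu; right.
- by apply: tri_au; left.
- by apply: tri_av; left.
- by apply: tri_av; left.
Qed.

Lemma rest_anchors e : e \in R -> exists b c,
  [/\ b \notin A, c \notin A, b != c, b \in vset e & [/\ c \in vset e, w e != b & w e != c]].
Proof.
move=> eR; have we := choice_funP e cw.
have /card_gt0P[b /setD1P[bw be]] : 0 < #|vset e :\ w e|.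
  by have := cardsD1 (w e) (vset e); rewrite we E3 add1n => -[<-].
have ab : anchored w e b by rewrite /anchored be bw.
have [c [ce cb h]] := anchored_pair cw (E3 e) ab.
have ac : anchored w e c by rewrite h eqxx (negPf cb).
exists b, c; split; rewrite ?(eq_sym b c) //.
- exact: rest_anchor_untouched cw evenR eR ab.
- exact: rest_anchor_untouched cw evenR eR ac.
- by split=> //; rewrite eq_sym //; case/andP: ac.
Qed.

Lemma rest_other e : e \in R -> exists2 e', e' \in R & e' != e.
Proof.
move=> eR; have [b [c [_ _ _ be [_ wb _]]]] := rest_anchors eR.
have := evenR b; rewrite (parityD1 w b eR) /anchored be eq_sym wb /=.
by move/negbFE/parity_true=> [e' /setD1P[e'e e'R] _]; exists e'.
Qed.

Lemma touched_nonempty : exists a, a \in A.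
Proof.
have [[[[x f] y] d]|T0] : (exists d, d \in T) \/ T = [::].
  by case: (T) => [|d T']; [right | left; exists d; rewrite inE eqxx].
  by exists x; exact: touched_src d.
have /set0Pn[e eR] := R0; have [b [c [_ _ _ be [_ wb _]]]] := rest_anchors eR.
have ab : anchored w e b by rewrite /anchored be eq_sym.
have [es [j u sub n0 ev]] := even_trail cw (fun e _ => E3 e) evenR eR ab.
by case: (no_growth j _ u sub n0 cw ev); rewrite T0 cats0.
Qed.

(** Otherwise the rest lies off [T], where [flip_exists] flips all pairs. A touched vertex is then
    visited with each vertex of an edge of the rest as spare, against [visits3_noflip]. *)
Lemma some_near b0 : b0 \notin A -> exists2 a, a \in A & near a b0.
Proof.
move=> b0A.
have [/exists_inP[a aA na]|] := boolP [exists a in A, near a b0]; first by exists a.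
rewrite negb_exists_in => /forall_inP far.
have RB e : e \in R -> vset e \subset ~: A.
  move=> eR; apply/subsetP => v ve; rewrite inE; apply/negP => vA.
  have [b [c [bA _ _ be _]]] := rest_anchors eR.
  by case/negP: (far v vA); apply: near_all_or_none vA bA b0A (nearI eR ve be).
have Rcov a b : a \in ~: A -> b \in ~: A -> a != b ->
    exists2 e, e \in R & (a \in vset e) && (b \in vset e).
  by rewrite (in_setC a) (in_setC b) => aA bA ab; exact: untouched_pair.
have /set0Pn[e eR] := R0; have [e' e'R e'e] := rest_other eR.
have R2 : (3 < #|~: A|) || (1 < #|R|).
  by apply/orP; right; apply/card_gt1P; exists e', e.
have fl x y := @flip_exists _ R (~: A) w cw (fun e _ => E3 e) RB Rcov x y R2.
have [b [c [bA cA bc be [ce wb wc]]]] := rest_anchors eR.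
have we := choice_funP e cw; have weB := subsetP (RB e eR) _ we.
have wA : w e \notin A by rewrite -in_setC.
have [a aA] := touched_nonempty.
have farA v : v \notin A -> exists f, visits a f v.
  move=> vA; apply: far_visits => //; apply: contra (far a aA).
  exact: near_all_or_none.
have [f1 v1] := farA b bA; have [f2 v2] := farA c cA; have [f3 v3] := farA (w e) wA.
have bB : b \in ~: A by rewrite in_setC.
have cB : c \in ~: A by rewrite in_setC.
have bw : b != w e by rewrite eq_sym.
have cw' : c != w e by rewrite eq_sym.
by case: (visits3_noflip bc bw cw' v1 v2 v3); apply: fl.
Qed.

(** Otherwise the spare and the entry vertex of a dart could be flipped, against [spare_noflip]. *)
Lemma some_far b0 : b0 \notin A -> exists2 a, a \in A & ~~ near a b0.
Proof.
move=> b0A.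
have [/exists_inP[a aA na]|] := boolP [exists a in A, ~~ near a b0]; first by exists a.
rewrite negb_exists_in => /forall_inP h.
have {}h a : a \in A -> near a b0 by move=> /h/negbNE.
have [a] := touched_nonempty; rewrite inE => /hasP[[[x0 f] y0] d _].
have /spare_exists[x [y [p s]]] : f \in F by apply/dart_edgesP; exists x0, y0.
have [d' _ [_ px _] _] := spareP s; have xA := touched_src d'.
have [nf _] := spare_noflip s; case: nf.
have [pA|pA] := boolP (p \in A); first exact: near_flip2 (h p pA) (h x xA).
apply: flipC; apply: near_flip => //.
exact: near_all_or_none xA b0A pA (h x xA).
Qed.

(** Two near vertices can be flipped, so they are the ends of any edge of [T] on them, and its spare
    [p] is touched and far. A visit to [p] with spare [b0] forbids flipping [b0] with one of the
    ends, although both are near. *)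
Lemma near_unique b0 a a' : b0 \notin A -> a \in A -> a' \in A ->
  near a b0 -> near a' b0 -> a = a'.
Proof.
move=> b0A aA a'A na na'; apply/eqP/contraT => aa'.
have fl := near_flip2 aA a'A aa' b0A na na'.
have [f fF /andP[af a'f]] := touched_pair aa' aA a'A.
have [s [t [p sp]]] := spare_exists fF; have [d _ _ h] := spareP sp.
have ap : a != p.
  apply/eqP => ap; rewrite -ap in sp.
  have a'a : a' != a by rewrite eq_sym.
  by case: (visits_noflip (spare_visits sp a'f a'a)); exact: flipC.
have a'p : a' != p.
  apply/eqP => ap'; rewrite -ap' in sp.
  by case: (visits_noflip (spare_visits sp af aa')).
have nf := visits_noflip (spare_visits sp af ap).
have [sA tA ns nt] : [/\ s \in A, t \in A, near s b0 & near t b0].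
  case: (h a af) => E; case: (h a' a'f) => E'; rewrite -?E -?E'; split=> //;
    by [rewrite E eqxx in ap | rewrite E' eqxx in a'p | rewrite E E' eqxx in aa'].
have [pA|pA] := boolP (p \in A); last first.
  by case: nf; apply: near_flip => //; exact: near_all_or_none na.
have [np|np] := boolP (near p b0).
  by case: nf; exact: near_flip2 na np.
have ne v : v \in A -> v != b0 by apply: contraTneq => ->.
have [g [vg|vg]] := far_visits pA b0A np.
  by case: (spare_enter_noflip (ne s sA) sp vg); exact: near_flip.
by case: (spare_leave_noflip (ne t tA) sp vg); exact: near_flip.
Qed.

Lemma near_edges b0 a : b0 \notin A -> a \in A -> near a b0 ->
  exists b1, [/\ b1 \notin A, b1 != b0, near a b1 & flip R w b0 b1].
Proof.
move=> b0A aA na; have [r [rR ar b0r wr sl]] := nearP aA b0A na.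
have [r' [r'R r'r ar']] : exists r', [/\ r' \in R, r' != r & a \in vset r'].
  have [/exists_inP[r' r'R /andP[r'r ar']]|] :=
    boolP [exists r' in R, (r' != r) && (a \in vset r')]; first by exists r'.
  (* If only [r] contained [a], the vertices of another edge of the rest would be untouched, hence
     near [a], hence among the two vertices of [r] other than [a]. *)
  rewrite negb_exists_in => /forall_inP only.
  have [e eR er] := rest_other rR; have ae : a \notin vset e.
    by have := only e eR; rewrite er.
  have sub : vset e \subset vset r :\ a.
    apply/subsetP => v ve; have va : v != a by apply: contraNneq ae => <-.
    rewrite !inE va /=; have vA : v \notin A.
      apply: contra va => vA; apply/eqP; apply: (near_unique b0A vA aA _ na).
      have [b [c [bA _ _ be _]]] := rest_anchors eR.
      exact: near_all_or_none vA bA b0A (nearI eR ve be).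
    have /exists_inP[r2 r2R /andP[ar2 vr2]] := near_all_or_none aA b0A vA na.
    have := only r2 r2R; rewrite ar2 andbT negbK => /eqP E.
    by rewrite -E.
  have := subset_leq_card sub; have := cardsD1 a (vset r); rewrite ar !E3 add1n.
  by case=> <-.
have wr' := rest_touched r'R ar' aA.
have [b1 [_ [b1A _ _ b1r' [_ wb1 _]]]] := rest_anchors r'R.
have sl' : slides w r' a b1 by rewrite /slides ar' b1r' wr' eqxx -wr' wb1.
exists b1; split=> //; last by apply: flip2 rR r'R _ _ sl' => //; rewrite 1?slidesC // eq_sym.
  (* Moving the choices on [r] and [r'] both from [a] to [b0] would keep all parities and make the
     touched vertex [a] an anchor. *)
  apply/eqP => E; subst b1.
  pose w1 := update w r b0; have cw1 : choice_fun w1 by exact: update_choice.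
  have cw2 : choice_fun (update w1 r' b0) by exact: update_choice.
  have : a \notin A; last by rewrite aA.
  apply: (rest_anchor_untouched cw2 _ rR) => [v|].
    rewrite (parity_update v cw1 r'R b1r') (parity_update v cw rR b0r).
    rewrite evenR wr ffunE (negPf r'r) wr'.
    by case: (v == a); case: (v == b0).
  by rewrite /anchored ar !ffunE eqxx [r == r']eq_sym (negPf r'r) -wr' wb1.
exact: nearI r'R ar' b1r'.
Qed.

(** Let [f] be an edge of [T] on the near [a] and a far [x]. If [a] is its spare, [x] is visited
    with spares [a], [b0], [b1], which can be flipped pairwise. Otherwise its spare [p] is touched
    and far, and [T] visits [p] with spares [b0] and [b1] in opposite directions; whichever end of
    [f] is [a], one of these visits forbids a flip of [a] that nearness provides. *)
Lemma maximal_contradiction : False.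
Proof.
have /set0Pn[e eR] := R0; have [b0 [_ [b0A _ _ _ _]]] := rest_anchors eR.
have [a aA na] := some_near b0A; have [x xA nx] := some_far b0A.
have [b1 [b1A b10 na1 fl01]] := near_edges b0A aA na.
have fla b : b \notin A -> near a b -> flip R w a b by exact: near_flip.
have far z b : z \in A -> ~~ near z b0 -> b \notin A -> exists f, visits z f b.
  move=> zA nz bA; apply: far_visits => //; apply: contra nz.
  exact: near_all_or_none.
have xa : x != a by apply: contraNneq nx => ->.
have b01 : b0 != b1 by rewrite eq_sym.
have ne b : b \notin A -> a != b by apply: contraNneq => <-.
have [f fF /andP[xf af]] := touched_pair xa xA aA.
have [s [t [p sp]]] := spare_exists fF.
have [ap|ap] := eqVneq a p.
  rewrite -ap in sp; have [f0 v0] := far x b0 xA nx b0A.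
  have [f1 v1] := far x b1 xA nx b1A.
  apply: (visits3_noflip (ne _ b0A) (ne _ b1A) b01 (spare_visits sp xf xa) v0 v1) => //.
  - exact: fla.
  - exact: fla.
have nf := visits_noflip (spare_visits sp af ap).
have [pA|pA] := boolP (p \in A); last first.
  by case: nf; apply: fla => //; exact: near_all_or_none na.
have np : ~~ near p b0.
  by apply: contra ap => np; apply/eqP; exact: near_unique na np.
have [f0 v0] := far p b0 pA np b0A; have [f1 v1] := far p b1 pA np b1A.
have [in_b out_b] : (exists g b, [/\ enters p g b, b \notin A & near a b]) /\
    (exists g b, [/\ leaves p g b, b \notin A & near a b]).
  case: v0 v1 => v0 [] v1.
  - by case: (same_enter_noflip b01 v0 v1).
  - by split; [exists f0, b0 | exists f1, b1].
  - by split; [exists f1, b1 | exists f0, b0].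
  - by case: (same_leave_noflip b01 v0 v1).
have [_ _ _ h] := spareP sp; case: (h a af) => E.
- rewrite -E in sp; have [g [b [vb bA nb]]] := in_b.
  by case: (spare_enter_noflip (ne _ bA) sp vb); exact: fla.
- rewrite -E in sp; have [g [b [vb bA nb]]] := out_b.
  by case: (spare_leave_noflip (ne _ bA) sp vb); exact: fla.
- by rewrite E eqxx in ap.
Qed.

End Triples.

(** * The case of triples and the conclusion *)

Lemma Euler_tour_3 (H : hypergraph) : covering_hypergraph 3 H ->
  2 <= #|edge H| -> has_Euler_tour H.
Proof.
move=> hH E2; have E3 (e : edge H) : #|vset e| = 3 by case: hH.
have pair_cover (a b : vertex H) : a != b ->
    exists e : edge H, (a \in vset e) && (b \in vset e).
  move=> ab; case: hH => _ _ /(_ [set a; b]); rewrite cards2 ab => /(_ erefl)[e /subsetP s].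
  by exists e; rewrite !s // !inE eqxx ?orbT.
have flipT w x y : choice_fun w -> x != y -> flip [set: edge H] w x y.
  move=> cw xy; apply: (@flip_exists _ _ setT w cw (fun e _ => E3 e)); rewrite ?in_setT //.
  - by move=> a b _ _ /pair_cover[e h]; exists e; rewrite ?in_setT.
  - by rewrite [#|[set: edge H]|]cardsT E2 orbT.
have [w0 cw0 ev0] := even_choice E3 flipT.
pose P (T : seq (dart H)) := closed_trail T &&
  [exists w, choice_fun w && [forall v, ~~ parity (~: [set e in dart_edges T]) w v]].
have [x0 _] := card_gt0P (vertex_nonempty H).
have [||T] := @longest_trail H P.
- apply/andP; split; first by rewrite /closed_trail andbT; apply/existsP; exists x0 => /=.
  apply/existsP; exists w0; rewrite cw0; apply/forallP => v.
  by rewrite (_ : ~: _ = setT) ?ev0 //; apply/setP => e; rewrite !inE.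
- by move=> T /andP[/andP[]].
case/andP=> cT /existsP[w /andP[cw /forallP ev]] Tmax.
apply: (closed_trail_Euler cT) => [|e]; first exact: ltnW.
apply: contraT => eF; case: (@maximal_contradiction H E3 pair_cover T w) => //.
- by move=> v; apply: negPf.
- move=> x es w' j u cw' ev'; have [T' cT' eT'] := joins_closed_trail j u.
  rewrite -eT' size_map; apply: Tmax; rewrite /P cT'; apply/existsP; exists w'.
  by rewrite cw' eT'; apply/forallP => v; rewrite ev'.
- by apply/set0Pn; exists e; rewrite !inE.
Qed.

Theorem theorem1p1 (k : nat) (hk : 3 <= k) (H : hypergraph)
  (hH : covering_hypergraph k H) :
  has_Euler_tour H <-> 2 <= #|edge H|.
Proof.
split=> [[v [s [[_ u] [_ s2] _]]]|E2].
  apply: leq_trans s2 _; rewrite -(size_map fst) -/(walk_edges s) -(card_uniqP u).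
  exact: max_card.
have [k4|k3] := ltnP 3 k; first exact: Euler_tour_ge4 hk hH k4 E2.
by apply: Euler_tour_3 E2; rewrite (_ : 3 = k) //; apply/eqP; rewrite eqn_leq hk.
Qed.
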